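(* Let $M$ be a countable transitive model of $\mathsf{ZF}^-$ and let $\mathbb{P}$ be a separative partial order that is definable over $M$. If either the power set axiom holds in $M$ or there is a well-ordering of $M$ that is definable over $M$, then the following statements are equivalent. (1) $\mathbb{P}$ satisfies the forcing theorem for all $\mathcal{L}_\in$-formulae over $M$. (2) $\mathbb{P}$ has a Boolean completion in $M$.
   Context: We work in a model $\mathsf{V}$ of $\mathsf{ZFC}$. $\mathsf{ZF}^-$ denotes the axioms of $\mathsf{ZF}$ without the power set axiom and with Collection instead of Replacement. $\mathcal{L}_\in$ is the first-order language of set theory. ''Definable over $M$'' means first-order definable over $\langle M,\in\rangle$, parameters from $M$ being allowed; a partial order $\mathbb{P}$ is definable over $M$ if both its domain (a subset of $M$) and its relation $\leq_{\mathbb{P}}$ are definable over $M$. $\mathbb{P}$ is separative if for all $p,q\in\mathbb{P}$ with $p\not\leq q$ there is $r\leq p$ such that $r$ and $q$ are incompatible. A filter $G$ on $\mathbb{P}$ is $\mathbb{P}$-generic over $M$ if it meets every dense subset of $\mathbb{P}$ that is definable over $M$. A $\mathbb{P}$-name is a set all of whose elements are of the form $\langle\tau,p\rangle$ with $\tau$ a $\mathbb{P}$-name and $p\in\mathbb{P}$; $M^{\mathbb{P}}$ is the collection of all $\mathbb{P}$-names in $M$. For a $\mathbb{P}$-generic filter $G$ let $\sigma^G=\{\tau^G\mid \exists p\in G\ \langle\tau,p\rangle\in\sigma\}$ and $M[G]=\{\sigma^G\mid\sigma\in M^{\mathbb{P}}\}$. Write $p\Vdash^M_{\mathbb{P}}\varphi(\sigma_0,\ldots,\sigma_{n-1})$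 if $\varphi(\sigma_0^G,\ldots,\sigma_{n-1}^G)$ holds in $M[G]$ whenever $G$ is $\mathbb{P}$-generic over $M$ with $p\in G$. $\mathbb{P}$ satisfies the forcing theorem for $\varphi$ over $M$ if (a) (definability lemma) the set $\{\langle p,\sigma_0,\ldots,\sigma_{n-1}\rangle\in\mathbb{P}\times M^{\mathbb{P}}\times\cdots\times M^{\mathbb{P}}\mid p\Vdash^M_{\mathbb{P}}\varphi(\sigma_0,\ldots,\sigma_{n-1})\}$ is definable over $M$, and (b) (truth lemma) for all $\sigma_0,\ldots,\sigma_{n-1}\in M^{\mathbb{P}}$ and every $\mathbb{P}$-generic filter $G$ over $M$ such that $\varphi(\sigma_0^G,\ldots,\sigma_{n-1}^G)$ holds in $M[G]$, there is $p\in G$ with $p\Vdash^M_{\mathbb{P}}\varphi(\sigma_0,\ldots,\sigma_{n-1})$. A Boolean algebra $\mathbb{B}$ is definable over $M$ if its domain and all its Boolean operations are definable over $M$; such a $\mathbb{B}$ is $M$-complete if $\sup_{\mathbb{B}}A$ exists in $\mathbb{B}$ for every $A\subseteq\mathbb{B}$ with $A\in M$. $\mathbb{P}$ has a Boolean completion in $M$ if there is an $M$-complete Boolean algebra $\mathbb{B}$ and an injective dense embedding $\pi$ of $\mathbb{P}$ into $\mathbb{B}\setminus\{0_{\mathbb{B}}\}$ (that is, an injective map with $p\leq q\Leftrightarrow\pi(p)\leq\pi(q)$ whose range is dense in $\mathbb{B}\setminus\{0_{\mathbb{B}}\}$) such that both $\mathbb{B}$ and $\pi$ are definable over $M$. 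*)

(* Defs.v *)
From HB Require Import structures.
From mathcomp Require Import all_boot.
From mathcomp Require Import boolp classical_sets functions cardinality.
From Stdlib Require Import Wellfounded.

Set Implicit Arguments.
Unset Strict Implicit.
Unset Printing Implicit Defensive.

Local Open Scope classical_set_scope.

(** * The universe of sets *)

(* The universe V is the cumulative hierarchy built from well-founded trees:
   a tree denotes the set of the denotations of its immediate subtrees, and V
   is the quotient by extensional equality, so that Leibniz equality on V is
   equality of sets.  The lemmas [V_extensionality] to [V_choice] show that V
   satisfies ZFC (with Replacement for arbitrary class functions). *)
Inductive tree : Type := node (A : Type) (f : A -> tree).

Fixpoint eqv (s t : tree) : Prop :=
  match s, t with
  | node A f, node B g =>
      (forall a, exists b, eqv (f a) (g b)) /\
      (forall b, exists a, eqv (f a) (g b))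
  end.

Lemma eqv_refl t : eqv t t.
Proof. by elim: t => A f IH; split=> a; exists a. Qed.

Lemma eqv_sym s t : eqv s t -> eqv t s.
Proof.
elim: s t => A f IH [B g] [fg gf]; split.
- by move=> b; have [a ?] := gf b; exists a; apply: IH.
- by move=> a; have [b ?] := fg a; exists b; apply: IH.
Qed.

Lemma eqv_trans s t u : eqv s t -> eqv t u -> eqv s u.
Proof.
elim: s t u => A f IH [B g] [C h] [fg gf] [gh hg]; split.
- move=> a; have [b ab] := fg a; have [c bc] := gh b.
  by exists c; exact: IH ab bc.
- move=> c; have [b bc] := hg c; have [a ab] := gf b.
  by exists a; exact: IH ab bc.
Qed.

Definition V : Type := {c : tree -> Prop | exists t, c = eqv t}.

HB.instance Definition _ := gen_eqMixin V.
HB.instance Definition _ := gen_choiceMixin V.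

Definition cls (t : tree) : V := exist _ (eqv t) (ex_intro _ t erefl).

Definition repr (x : V) : tree := sval (cid (svalP x)).

Lemma reprK x : cls (repr x) = x.
Proof.
case: x => c h; apply: eq_exist; rewrite /repr.
by case: (cid _) => t /= ->.
Qed.

Lemma cls_eq s t : cls s = cls t <-> eqv s t.
Proof.
split=> [/(f_equal sval) /= ->|st]; first exact: eqv_refl.
apply: eq_exist; apply/predeqP => u; split; last exact: eqv_trans.
by apply: eqv_trans; exact: eqv_sym.
Qed.

Definition node_index (t : tree) : Type := let: node A _ := t in A.

Definition node_child (t : tree) : node_index t -> tree :=
  let: node A f := t in f.

Definition idx (x : V) : Type := node_index (repr x).

Definition el (x : V) (i : idx x) : V := cls (node_child i).

Definition mem (x y : V) : Prop := exists i : idx y, el i = x.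

Definition elts (x : V) : set V := [set y | mem y x].

Definition family (A : Type) (f : A -> V) : V := cls (node (repr \o f)).

Lemma mem_cls x A (f : A -> tree) :
  mem x (cls (node f)) <-> exists a, cls (f a) = x.
Proof.
have: eqv (repr (cls (node f))) (node f) by apply/cls_eq; rewrite reprK.
rewrite /mem /el /idx; case: (repr _) => B g /= [gf fg]; split.
- by move=> [b <-]; have [a ?] := gf b; exists a; apply/esym/cls_eq.
- by move=> [a <-]; have [b ?] := fg a; exists b; apply/cls_eq.
Qed.

Lemma mem_family x A (f : A -> V) : mem x (family f) <-> exists a, f a = x.
Proof.
by rewrite mem_cls; split=> -[a <-]; exists a; rewrite /= reprK.
Qed.

Lemma V_extensionality x y : (forall z, mem z x <-> mem z y) -> x = y.
Proof.
move=> xy; rewrite -(reprK x) -(reprK y); apply/cls_eq.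
move: xy; rewrite /mem /el /idx.
case: (repr x) => A f; case: (repr y) => B g /= xy; split.
- move=> a; have /xy[b /esym/cls_eq ?] : exists i, cls (f i) = cls (f a).
    by exists a.
  by exists b.
- move=> b; have /xy[a /cls_eq ?] : exists i, cls (g i) = cls (g b).
    by exists b.
  by exists a.
Qed.

Lemma mem_wf : well_founded mem.
Proof.
move=> x; rewrite -(reprK x); elim: (repr x) => A f IH.
by constructor=> y /mem_cls[a <-].
Qed.

Lemma V_foundation x : (exists y, mem y x) ->
  exists2 y, mem y x & forall z, mem z y -> ~ mem z x.
Proof.
move=> [y yx]; elim/(well_founded_ind mem_wf): y yx => y IH yx.
have [[z zy zx]|Nz] := pselect (exists2 z, mem z y & mem z x).
  exact: IH zy zx.
by exists y => // z zy zx; apply: Nz; exists z.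
Qed.

Definition emptyset : V := family (fun i : void => match i with end).

Definition upair (x y : V) : V := family (fun b : bool => if b then x else y).

Definition pair (x y : V) : V := upair (upair x x) (upair x y).

Lemma mem_emptyset x : ~ mem x emptyset.
Proof. by move=> /mem_family[[]]. Qed.

Lemma mem_upair z x y : mem z (upair x y) <-> z = x \/ z = y.
Proof.
rewrite mem_family; split=> [[[] <-]|[->|->]]; [by left|by right| |].
- by exists true.
- by exists false.
Qed.

Lemma V_pairing x y : exists z, forall w, mem w z <-> w = x \/ w = y.
Proof. by exists (upair x y) => w; exact: mem_upair. Qed.

Lemma V_union x :
  exists u, forall z, mem z u <-> exists2 y, mem y x & mem z y.
Proof.
exists (family (fun p : {i : idx x & idx (el i)} => el (projT2 p))) => z.
rewrite mem_family; split=> [[[i j] <-]|[_ [i <-] [j <-]]].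
- by exists (el i); [exists i|exists j].
- by exists (existT _ i j).
Qed.

Lemma V_separation x (Q : set V) :
  exists y, forall z, mem z y <-> mem z x /\ Q z.
Proof.
exists (family (fun p : {i : idx x | Q (el i)} => el (sval p))) => z.
rewrite mem_family; split=> [[[i Qi] <-]|[[i <-] Qi]].
- by split=> //; exists i.
- by exists (exist _ i Qi).
Qed.

Lemma V_powerset x :
  exists y, forall z, mem z y <-> (forall w, mem w z -> mem w x).
Proof.
exists (family (fun S : idx x -> Prop =>
  family (fun p : {i : idx x | S i} => el (sval p)))) => z.
rewrite mem_family; split.
- by move=> [S <-] w /mem_family[[i Si] <-]; exists i.
- move=> zx; exists (fun i => mem (el i) z); apply: V_extensionality => w.
  rewrite mem_family; split=> [[[i iz] <-]//|wz].
  by have [i iw] := zx _ wz; rewrite -iw in wz *; exists (exist _ i wz).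
Qed.

Lemma V_infinity : exists2 x, mem emptyset x &
  forall y, mem y x ->
    exists2 s, mem s x & forall z, mem z s <-> mem z y \/ z = y.
Proof.
have succP y : exists s, forall z, mem z s <-> mem z y \/ z = y.
  have [u uP] := V_union (upair y (upair y y)).
  exists u => z; rewrite uP; split.
  - move=> [w] /mem_upair[->|->]; first by left.
    by move=> /mem_upair[]->; right.
  - by move=> [zy|->]; [exists y|exists (upair y y)] => //;
      apply/mem_upair; auto.
pose succ y := sval (cid (succP y)).
exists (family (fun n => iter n succ emptyset)).
- by apply/mem_family; exists 0.
- move=> _ /mem_family[n <-]; exists (succ (iter n succ emptyset)).
    by apply/mem_family; exists n.+1.
  exact: svalP (cid (succP _)).
Qed.

Lemma V_replacement (F : V -> V) x :
  exists y, forall z, mem z y <-> exists2 w, mem w x & F w = z.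
Proof.
exists (family (fun i : idx x => F (el i))) => z; rewrite mem_family.
by split=> [[i <-]|[_ [i <-] <-]]; [exists (el i) => //; exists i|exists i].
Qed.

Lemma V_choice x : (forall y, mem y x -> exists z, mem z y) ->
  (forall y y' z, mem y x -> mem y' x -> mem z y -> mem z y' -> y = y') ->
  exists c, forall y, mem y x -> exists! z, mem z c /\ mem z y.
Proof.
move=> x0 xd.
have /choice[f fP] y : exists z, mem y x -> mem z y.
  have [/x0[z zy]|Nyx] := pselect (mem y x); first by exists z.
  by exists emptyset.
have [c cP] := V_replacement f x; exists c => y yx; exists (f y); split.
  by split; [apply/cP; exists y|exact: fP].
move=> z [/cP[y' y'x <-] fy'].
by rewrite (xd _ _ _ yx y'x fy' (fP _ y'x)).
Qed.

(** * First-order formulas and satisfaction *)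

(* De Bruijn indices: in [fEx phi] the index 0 of [phi] is bound. *)
Inductive formula : Type :=
| fMem of nat & nat
| fEq of nat & nat
| fNot of formula
| fAnd of formula & formula
| fEx of formula.

Fixpoint fv_below (n : nat) (phi : formula) : bool :=
  match phi with
  | fMem i j | fEq i j => (i < n) && (j < n)
  | fNot psi => fv_below n psi
  | fAnd psi chi => fv_below n psi && fv_below n chi
  | fEx psi => fv_below n.+1 psi
  end.

Definition scons (x : V) (e : nat -> V) (i : nat) : V :=
  if i is j.+1 then e j else x.

Definition env (s : seq V) (e : nat -> V) : nat -> V := foldr scons e s.

(* Satisfaction in the structure (M, mem). *)
Fixpoint sat (M : set V) (phi : formula) (e : nat -> V) : Prop :=
  match phi with
  | fMem i j => mem (e i) (e j)
  | fEq i j => e i = e j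
  | fNot psi => ~ sat M psi e
  | fAnd psi chi => sat M psi e /\ sat M chi e
  | fEx psi => exists2 x, M x & sat M psi (scons x e)
  end.

(* Definability over M of an n-ary relation on M.  A formula has finitely many
   free variables, so only finitely many values of [e] serve as parameters. *)
Definition definable (M : set V) (n : nat) (R : set (seq V)) : Prop :=
  exists (phi : formula) (e : nat -> V), (forall i, M (e i)) /\
    forall s, R s <->
      [/\ size s = n, (forall x, x \in s -> M x) & sat M phi (env s e)].

Definition definable_set (M A : set V) : Prop :=
  definable M 1 [set s | if s is [:: x] then A x else False].

Definition definable_rel (M A : set V) (R : V -> V -> Prop) : Prop :=
  definable M 2 [set s | if s is [:: x; y] then [/\ A x, A y & R x y]
                         else False].

Definition definable_fun1 (M A : set V) (f : V -> V) : Prop :=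
  definable M 2 [set s | if s is [:: x; y] then A x /\ y = f x else False].

Definition definable_fun2 (M A : set V) (f : V -> V -> V) : Prop :=
  definable M 3 [set s | if s is [:: x; y; z]
                         then [/\ A x, A y & z = f x y] else False].

(** * Transitive models of ZF without Power Set *)

Definition is_transitive (M : set V) : Prop :=
  forall x y, M x -> mem y x -> M y.

Record ZFminus (M : set V) : Prop := {
  ax_extensionality : forall x y, M x -> M y ->
    (forall z, M z -> (mem z x <-> mem z y)) -> x = y;
  ax_foundation : forall x, M x -> (exists2 y, M y & mem y x) ->
    exists y, [/\ M y, mem y x & forall z, M z -> ~ (mem z y /\ mem z x)];
  ax_pairing : forall x y, M x -> M y -> exists2 z, M z &
    forall w, M w -> (mem w z <-> w = x \/ w = y);
  ax_union : forall x, M x -> exists2 u, M u &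
    forall z, M z -> (mem z u <-> exists y, [/\ M y, mem y x & mem z y]);
  ax_infinity : exists x, [/\ M x,
    exists o, [/\ M o, mem o x & forall z, M z -> ~ mem z o] &
    forall y, M y -> mem y x -> exists s, [/\ M s, mem s x &
      forall z, M z -> (mem z s <-> mem z y \/ z = y)]];
  ax_separation : forall (phi : formula) (e : nat -> V),
    (forall i, M (e i)) -> forall a, M a -> exists2 b, M b &
    forall x, M x -> (mem x b <-> mem x a /\ sat M phi (env [:: x] e));
  ax_collection : forall (phi : formula) (e : nat -> V),
    (forall i, M (e i)) -> forall a, M a ->
    (forall x, M x -> mem x a ->
       exists2 y, M y & sat M phi (env [:: x; y] e)) ->
    exists2 b, M b & forall x, M x -> mem x a ->
       exists y, [/\ M y, mem y b & sat M phi (env [:: x; y] e)]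
}.

Definition powerset_axiom (M : set V) : Prop :=
  forall x, M x -> exists2 y, M y &
    forall z, M z -> (mem z y <-> (forall w, M w -> mem w z -> mem w x)).

Record is_well_order (A : set V) (R : V -> V -> Prop) : Prop := {
  wo_refl : forall x, A x -> R x x;
  wo_antisym : forall x y, A x -> A y -> R x y -> R y x -> x = y;
  wo_trans : forall x y z, A x -> A y -> A z -> R x y -> R y z -> R x z;
  wo_total : forall x y, A x -> A y -> R x y \/ R y x;
  wo_least : forall X : set V, X `<=` A -> X !=set0 ->
    exists2 x, X x & forall y, X y -> R x y
}.

(** * Partial orders, generic filters and names *)

Record porder : Type := POrder {
  dom : set V;
  ple : V -> V -> Prop;
  ple_refl : forall p, dom p -> ple p p;
  ple_antisym : forall p q, dom p -> dom q -> ple p q -> ple q p -> p = q;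
  ple_trans : forall p q r, dom p -> dom q -> dom r ->
    ple p q -> ple q r -> ple p r
}.

Definition porder_definable (M : set V) (P : porder) : Prop :=
  definable_set M (dom P) /\ definable_rel M (dom P) (ple P).

Definition incompatible (P : porder) (p q : V) : Prop :=
  ~ exists r, [/\ dom P r, ple P r p & ple P r q].

Definition separative (P : porder) : Prop :=
  forall p q, dom P p -> dom P q -> ~ ple P p q ->
    exists r, [/\ dom P r, ple P r p & incompatible P r q].

Record is_filter (P : porder) (G : set V) : Prop := {
  filter_sub : G `<=` dom P;
  filter_nonempty : G !=set0;
  filter_up : forall p q, G p -> dom P q -> ple P p q -> G q;
  filter_directed : forall p q, G p -> G q ->
    exists r, [/\ G r, ple P r p & ple P r q]
}.

Definition is_dense (P : porder) (D : set V) : Prop :=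
  D `<=` dom P /\ forall p, dom P p -> exists2 d, D d & ple P d p.

Definition generic (M : set V) (P : porder) (G : set V) : Prop :=
  is_filter P G /\
  forall D, is_dense P D -> definable_set M D -> (D `&` G) !=set0.

Inductive is_name (P : porder) (sigma : V) : Prop :=
| Name of (forall x, mem x sigma -> exists tau p,
             [/\ x = pair tau p, is_name P tau & dom P p]).

Definition names (M : set V) (P : porder) : set V :=
  [set sigma | M sigma /\ is_name P sigma].

Definition name_lt (tau sigma : V) : Prop := exists p, mem (pair tau p) sigma.

Lemma name_lt_wf : well_founded name_lt.
Proof.
apply: (wf_incl _ _ _ _ (wf_clos_trans _ _ mem_wf)) => tau sigma [p ps].
apply: Relation_Operators.t_trans (Relation_Operators.t_step _ _ _ _ ps).
apply: (@Relation_Operators.t_trans _ _ _ (upair tau tau));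
  by apply: Relation_Operators.t_step; apply/mem_upair; left.
Qed.

(* The evaluation of names, by recursion along [name_lt]; see [mem_val]. *)
Definition val_step (G : set V) (sigma : V)
    (rec : forall tau, name_lt tau sigma -> V) : V :=
  family (fun j : {i : idx sigma |
                    exists tau p, G p /\ el i = pair tau p} =>
    let: exist i h := j in
    let: exist tau h1 := cid h in
    let: exist p h2 := cid h1 in
    rec tau (ex_intro _ p (ex_intro _ i (proj2 h2)))).

Definition val (G : set V) : V -> V :=
  Fix name_lt_wf (fun=> V) (val_step G).

Lemma pair_inj x y x' y' : pair x y = pair x' y' -> x = x' /\ y = y'.
Proof.
move=> e.
have xx' : x = x'.
  have : mem (upair x x) (pair x' y') by rewrite -e; apply/mem_upair; left.
  move=> /mem_upair[] e'.
  - have /mem_upair[] // : mem x (upair x' x').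
    by rewrite -e'; apply/mem_upair; left.
  - have : mem x' (upair x x) by rewrite e'; apply/mem_upair; left.
    by move=> /mem_upair[].
subst x'; split=> //.
have h : y = x \/ y = y'.
  have : mem (upair x y) (pair x y') by rewrite -e; apply/mem_upair; right.
  move=> /mem_upair[] e'.
  - left; have /mem_upair[] // : mem y (upair x x).
    by rewrite -e'; apply/mem_upair; right.
  - by apply/mem_upair; rewrite -e'; apply/mem_upair; right.
have h' : y' = x \/ y' = y.
  have : mem (upair x y') (pair x y) by rewrite e; apply/mem_upair; right.
  move=> /mem_upair[] e'.
  - left; have /mem_upair[] // : mem y' (upair x x).
    by rewrite -e'; apply/mem_upair; right.
  - by apply/mem_upair; rewrite -e'; apply/mem_upair; right.
by case: h => // yx; case: h' => ->.
Qed.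

Lemma mem_val G sigma x : mem x (val G sigma) <->
  exists tau p, [/\ G p, mem (pair tau p) sigma & x = val G tau].
Proof.
have -> : val G sigma = val_step G (fun tau (_ : name_lt tau sigma) => val G tau).
  rewrite /val Fix_eq // => s f g fg; rewrite /val_step; congr family.
  apply: functional_extensionality_dep => -[i h].
  by case: (cid h) => tau h1; case: (cid h1).
rewrite mem_family; split.
- move=> [[i h]]; case: (cid h) => tau h1; case: (cid h1) => p [Gp ip] <-.
  by exists tau, p; split=> //; exists i.
- move=> [tau [p [Gp [i ip] ->]]].
  have h : exists tau p, G p /\ el i = pair tau p by exists tau, p.
  exists (exist _ i h); case: (cid h) => tau' h1; case: (cid h1) => p' [_].
  by rewrite ip => /pair_inj[->].
Qed.

Definition generic_extension (M : set V) (P : porder) (G : set V) : set V :=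
  val G @` names M P.

(** * The forcing theorem *)

(* [phi] has free variables among 0, ..., size sigma - 1, so that the default
   value [emptyset] in the environment is never used. *)
Definition sat_ext (M : set V) (P : porder) (G : set V) (phi : formula)
    (sigma : seq V) : Prop :=
  sat (generic_extension M P G) phi
      (env [seq val G tau | tau <- sigma] (fun=> emptyset)).

Definition forces (M : set V) (P : porder) (p : V) (phi : formula)
    (sigma : seq V) : Prop :=
  forall G, generic M P G -> G p -> sat_ext M P G phi sigma.

Definition name_seq (M : set V) (P : porder) (n : nat) : set (seq V) :=
  [set sigma | size sigma = n /\ forall tau, tau \in sigma -> names M P tau].

Definition definability_lemma (M : set V) (P : porder) (n : nat)
    (phi : formula) : Prop :=
  definable M n.+1
    [set s | if s is p :: sigma
             then [/\ dom P p, name_seq M P n sigma & forces M P p phi sigma]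
             else False].

Definition truth_lemma (M : set V) (P : porder) (n : nat)
    (phi : formula) : Prop :=
  forall sigma G, name_seq M P n sigma -> generic M P G ->
    sat_ext M P G phi sigma -> exists2 p, G p & forces M P p phi sigma.

Definition forcing_theorem (M : set V) (P : porder) (n : nat)
    (phi : formula) : Prop :=
  definability_lemma M P n phi /\ truth_lemma M P n phi.

(** * Boolean completions *)

(* The degenerate algebra 0 = 1 is allowed: it is the completion of the empty
   partial order, and cannot be one of a nonempty partial order. *)
Record boolalg : Type := BoolAlg {
  bdom : set V;
  bmeet : V -> V -> V;
  bjoin : V -> V -> V;
  bcompl : V -> V;
  bzero : V;
  bone : V;
  bmeet_dom : forall a b, bdom a -> bdom b -> bdom (bmeet a b);
  bjoin_dom : forall a b, bdom a -> bdom b -> bdom (bjoin a b);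
  bcompl_dom : forall a, bdom a -> bdom (bcompl a);
  bzero_dom : bdom bzero;
  bone_dom : bdom bone;
  bmeetC : forall a b, bdom a -> bdom b -> bmeet a b = bmeet b a;
  bjoinC : forall a b, bdom a -> bdom b -> bjoin a b = bjoin b a;
  bmeetA : forall a b c, bdom a -> bdom b -> bdom c ->
    bmeet a (bmeet b c) = bmeet (bmeet a b) c;
  bjoinA : forall a b c, bdom a -> bdom b -> bdom c ->
    bjoin a (bjoin b c) = bjoin (bjoin a b) c;
  bmeetK : forall a b, bdom a -> bdom b -> bmeet a (bjoin a b) = a;
  bjoinK : forall a b, bdom a -> bdom b -> bjoin a (bmeet a b) = a;
  bmeetDr : forall a b c, bdom a -> bdom b -> bdom c ->
    bmeet a (bjoin b c) = bjoin (bmeet a b) (bmeet a c);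
  bmeet_compl : forall a, bdom a -> bmeet a (bcompl a) = bzero;
  bjoin_compl : forall a, bdom a -> bjoin a (bcompl a) = bone
}.

Definition ble (B : boolalg) (a b : V) : Prop := bmeet B a b = a.

Definition boolalg_definable (M : set V) (B : boolalg) : Prop :=
  [/\ definable_set M (bdom B),
      definable_fun2 M (bdom B) (bmeet B),
      definable_fun2 M (bdom B) (bjoin B),
      definable_fun1 M (bdom B) (bcompl B) &
      definable_set M [set bzero B] /\ definable_set M [set bone B]].

Definition is_sup (B : boolalg) (A : set V) (s : V) : Prop :=
  [/\ bdom B s, (forall a, A a -> ble B a s) &
      forall u, bdom B u -> (forall a, A a -> ble B a u) -> ble B s u].

Definition complete_in (M : set V) (B : boolalg) : Prop :=
  forall A, M A -> elts A `<=` bdom B -> exists s, is_sup B (elts A) s.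

Record dense_embedding (P : porder) (B : boolalg) (pi : V -> V) : Prop := {
  emb_dom : forall p, dom P p -> bdom B (pi p) /\ pi p <> bzero B;
  emb_inj : forall p q, dom P p -> dom P q -> pi p = pi q -> p = q;
  emb_le : forall p q, dom P p -> dom P q ->
    (ple P p q <-> ble B (pi p) (pi q));
  emb_dense : forall b, bdom B b -> b <> bzero B ->
    exists2 p, dom P p & ble B (pi p) b
}.

Definition has_boolean_completion (M : set V) (P : porder) : Prop :=
  exists (B : boolalg) (pi : V -> V),
    [/\ boolalg_definable M B, complete_in M B, dense_embedding P B pi &
        definable_fun1 M (dom P) pi].

(* Main.v *)
(* From a completion B to the forcing theorem: the Boolean value of sigma = tau
   is computed in M by recursion on pairs of names, and the upward closure of a
   generic filter in B is an ultrafilter that respects suprema of sets in M, so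
   the atomic formulas are decided by B; the other formulas are handled by
   density arguments.

   From the forcing theorem to a completion: conditions p are compared through
   pairs of names (a, b) by means of the statement "p forces a = b".  Both
   "some nu_j = mu_j" and "all nu_j = mu_j", for families in M, are again
   single equations between names, so the pairs of equations exactly one of
   which holds in each generic extension are closed under complements and under
   suprema of sets in M.  The equation {(0, q)} = {(0, 1)} represents q.
   Identifying codes that are forced by the same conditions, with definable
   representatives given by a definable well-order or by Scott's trick, yields
   the completion; as M is countable, a class is determined by the generic
   filters in which it holds, so the Boolean laws are propositional. *)

Require Import Defs.
From mathcomp Require Import all_boot.
From mathcomp Require Import boolp classical_sets functions cardinality.
From Stdlib Require Import Wellfounded.
Import Defs.

Set Implicit Arguments.
Unset Strict Implicit.
Unset Printing Implicit Defensive.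

Local Open Scope classical_set_scope.

(** * Operations on sets *)

(** [P] may be a proper class of [M], so its regular open subsets need not be elements of [M]. In
    the first direction, completeness for sets in [M] limits what [B] can decide: the suprema needed
    for an atomic formula range over the elements of a name, which form a set in [M], whereas an
    existential quantifier would need a supremum over all names. Hence Boolean values stop at atomic
    formulas. In the other direction, equations between names serve as elements because a family of
    equations indexed by a set in [M] merges into one equation, while a family of formulas does not
    merge into one formula. The negation of an equation is not an equation, so a code carries a
    second equation for it, and by De Morgan a supremum needs disjunctions of the first equations
    and conjunctions of the second ones. The forcing theorem is then applied to two fixed
    quantifier-free formulas. Definability is obtained without writing formulas: predicates and
    terms on environments are closed under connectives, quantifiers over [M], substitution, set
    operations and well-founded recursion. *)

Definition sep (x : V) (Q : V -> Prop) : V := sval (cid (V_separation x Q)).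
Definition img (F : V -> V) (x : V) : V := sval (cid (V_replacement F x)).
Definition cup (x : V) : V := sval (cid (V_union x)).
Definition sing (x : V) : V := upair x x.
Definition cup2 (x y : V) : V := cup (upair x y).
(* [the Q] is [emptyset] when nothing satisfies [Q]. *)
Definition the (Q : V -> Prop) : V :=
  if pselect (exists x, Q x) is left h then sval (cid h) else emptyset.
Definition pfst (z : V) : V := the (fun a => exists b, z = pair a b).
Definition psnd (z : V) : V := the (fun b => exists a, z = pair a b).
(** The uniqueness clause makes the value determined for every set [f], function or not, as
    [dfnf_the] requires. *)
Definition app (f y : V) : V :=
  the (fun u => mem (pair y u) f /\ forall v, mem (pair y v) f -> v = u).
Definition prod (x y : V) : V :=
  cup (img (fun a => img (fun b => pair a b) y) x).

Lemma mem_sep z x Q : mem z (sep x Q) <-> mem z x /\ Q z.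
Proof. exact: svalP (cid (V_separation x Q)) z. Qed.

Lemma mem_img z F x : mem z (img F x) <-> exists2 w, mem w x & F w = z.
Proof. exact: svalP (cid (V_replacement F x)) z. Qed.

Lemma img_ext F F' x : (forall w, mem w x -> F w = F' w) -> img F x = img F' x.
Proof.
move=> h; apply: V_extensionality => z; rewrite !mem_img.
by split=> -[w wx <-]; exists w => //; rewrite h.
Qed.

Lemma mem_cup z x : mem z (cup x) <-> exists2 y, mem y x & mem z y.
Proof. exact: svalP (cid (V_union x)) z. Qed.

Lemma mem_sing z x : mem z (sing x) <-> z = x.
Proof. by rewrite mem_upair; split=> [[]|]; auto. Qed.

Lemma mem_cup2 z x y : mem z (cup2 x y) <-> mem z x \/ mem z y.
Proof.
rewrite mem_cup; split=> [[w /mem_upair[->|->]]|[]]; auto => h.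
- by exists x => //; apply/mem_upair; left.
- by exists y => //; apply/mem_upair; right.
Qed.

Lemma the_spec Q x : Q x -> Q (the Q).
Proof. by move=> Qx; rewrite /the; case: pselect => [h|[]]; [case: cid|exists x]. Qed.

Lemma the_eq Q x : (forall y, Q y -> y = x) -> Q x -> the Q = x.
Proof. by move=> u /the_spec/u. Qed.

Lemma the_none Q : ~ (exists x, Q x) -> the Q = emptyset.
Proof. by rewrite /the; case: pselect. Qed.

Lemma pfst_pair x y : pfst (pair x y) = x.
Proof. by apply: the_eq => [a [b /pair_inj[]]|]; last exists y. Qed.

Lemma psnd_pair x y : psnd (pair x y) = y.
Proof. by apply: the_eq => [b [a /pair_inj[]]|]; last exists x. Qed.

Lemma app_eq f y u : (forall v, mem (pair y v) f -> v = u) ->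
  mem (pair y u) f -> app f y = u.
Proof. by move=> u1 yf; apply: the_eq => [v [/u1]|]. Qed.

Lemma mem_prod z x y : mem z (prod x y) <->
  exists a b, [/\ mem a x, mem b y & z = pair a b].
Proof.
rewrite mem_cup; split.
- by move=> [_ /mem_img[a ax <-] /mem_img[b bY <-]]; exists a, b.
- move=> [a [b [ax bY ->]]]; exists (img (fun b => pair a b) y).
    by apply/mem_img; exists a.
  by apply/mem_img; exists b.
Qed.

(** * Definable predicates and definable terms *)

Section Formulas.
Variable M : set V.

Definition up (r : nat -> nat) (i : nat) : nat :=
  if i is j.+1 then (r j).+1 else 0.

Fixpoint ren (r : nat -> nat) (phi : formula) : formula :=
  match phi with
  | fMem i j => fMem (r i) (r j)
  | fEq i j => fEq (r i) (r j)
  | fNot psi => fNot (ren r psi)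
  | fAnd psi chi => fAnd (ren r psi) (ren r chi)
  | fEx psi => fEx (ren (up r) psi)
  end.

Lemma sat_ren phi r e :
  sat M (ren r phi) e <-> sat M phi (fun i => e (r i)).
Proof.
elim: phi r e => //= [psi IH|psi IH chi IH'|psi IH] r e.
- by rewrite IH.
- by rewrite IH IH'.
- have E x : (fun i => scons x e (up r i)) = scons x (fun i => e (r i)).
    by apply/funext; case.
  by split=> -[x Mx h]; exists x => //; move: h; rewrite IH E.
Qed.

Lemma sat_fv phi k e e' : fv_below k phi ->
  (forall i, i < k -> e i = e' i) -> (sat M phi e <-> sat M phi e').
Proof.
elim: phi k e e' => /= [i j|i j|psi IH|psi IH chi IH'|psi IH] k e e'.
- by move=> /andP[ik jk] h; rewrite !h.
- by move=> /andP[ik jk] h; rewrite !h.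
- by move=> fv h; rewrite (IH k e e').
- by move=> /andP[fv fv'] h; rewrite (IH k e e') // (IH' k e e').
- move=> fv h; have E x := IH k.+1 (scons x e) (scons x e') fv.
  by split=> -[x Mx hx]; exists x => //; apply/(E x) => // -[|i] //= ik; rewrite h.
Qed.

Lemma fv_below_mono phi k l : k <= l -> fv_below k phi -> fv_below l phi.
Proof.
elim: phi k l => /= [i j|i j|psi IH|psi IH chi IH'|psi IH] k l kl.
- by move=> /andP[ik jk]; rewrite !(leq_trans _ kl).
- by move=> /andP[ik jk]; rewrite !(leq_trans _ kl).
- exact: IH.
- by move=> /andP[/(IH _ _ kl) -> /(IH' _ _ kl) ->].
- exact: IH.
Qed.

Lemma fv_below_ex phi : exists k, fv_below k phi.
Proof.
elim: phi => /= [i j|i j|psi [k h]|psi [k h] chi [l h']|psi [k h]].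
- by exists (maxn i j).+1; rewrite !ltnS leq_maxl leq_maxr.
- by exists (maxn i j).+1; rewrite !ltnS leq_maxl leq_maxr.
- by exists k.
- exists (maxn k l); rewrite (fv_below_mono (leq_maxl k l) h).
  exact: fv_below_mono (leq_maxr k l) h'.
- by exists k; apply: fv_below_mono h.
Qed.

Lemma env_nth s e x0 i :
  env s e i = if i < size s then nth x0 s i else e (i - size s).
Proof. by elim: s i => [|x s IH] [|i] //=; rewrite ?subn0 // IH ltnS subSS. Qed.

Lemma env_M s e : (forall x, x \in s -> M x) -> (forall i, M (e i)) ->
  forall i, M (env s e i).
Proof.
elim: s => [|x s IH] //= h he [|i] /=; first by apply: h; rewrite mem_head.
by apply: IH => // y ys; apply: h; rewrite in_cons ys orbT.
Qed.

Definition inM (e : nat -> V) : Prop := forall i, M (e i).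

(* An assignment sends each variable of a formula either to a variable of the
   context or to a constant of M. *)
Definition asg (t : nat -> nat + V) (e : nat -> V) (i : nat) : V :=
  match t i with inl j => e j | inr v => v end.

Definition consts_in (t : nat -> nat + V) : Prop :=
  forall i v, t i = inr v -> M v.

(** Predicates on whole environments avoid fixing an arity, so that the closure lemmas compose
    freely; [dfn_env] returns to tuples. *)
Definition dfn (Q : (nat -> V) -> Prop) : Prop :=
  exists phi t, consts_in t /\
    forall e, inM e -> (Q e <-> sat M phi (asg t e)).

(** The graph of a term, with the value in variable 0 and the arguments shifted. Closure of [M]
    under the term lets its value be named by a quantifier over [M]. *)
Definition dfnf (h : (nat -> V) -> V) : Prop :=
  (forall e, inM e -> M (h e)) /\ dfn (fun e => e 0 = h (fun i => e i.+1)).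

Lemma inM_scons x e : M x -> inM e -> inM (scons x e).
Proof. by move=> Mx h [|i] //=. Qed.

Lemma dfn_iff Q Q' : (forall e, inM e -> (Q e <-> Q' e)) -> dfn Q -> dfn Q'.
Proof.
by move=> QQ' [phi [t [tM h]]]; exists phi, t; split=> // e eM; rewrite -QQ' // h.
Qed.

Lemma dfn_not Q : dfn Q -> dfn (fun e => ~ Q e).
Proof.
by move=> [phi [t [tM h]]]; exists (fNot phi), t; split=> // e eM /=; rewrite -h.
Qed.

Lemma dfn_and Q Q' : dfn Q -> dfn Q' -> dfn (fun e => Q e /\ Q' e).
Proof.
move=> [phi [t [tM h]]] [phi' [t' [tM' h']]].
(* Each formula has its own assignment of constants; the two are interleaved on even and odd
   variables. *)
exists (fAnd (ren double phi) (ren (fun i => i.*2.+1) phi')).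
exists (fun i => if odd i then t' i./2 else t i./2); split.
  by move=> i v; case: ifP => _; [exact: tM'|exact: tM].
move=> e eM /=; rewrite !sat_ren h // h' //.
rewrite /asg; set f := (X in sat M phi X); set g := (X in sat M phi' X).
have -> : (fun i : nat => match (if odd i.*2 then t' i.*2./2 else t i.*2./2)
    with inl j => e j | inr v => v end) = f.
  by apply/funext => i; rewrite odd_double doubleK.
suff -> : (fun i : nat => match (if odd i.*2.+1 then t' i.*2.+1./2 else t i.*2.+1./2)
    with inl j => e j | inr v => v end) = g by [].
by apply/funext => i; rewrite oddS odd_double -uphalfE uphalf_double.
Qed.

Lemma dfn_and3 A B C : dfn A -> dfn B -> dfn C ->
  dfn (fun e => [/\ A e, B e & C e]).
Proof.
move=> a b c; apply: (dfn_iff _ (dfn_and a (dfn_and b c))) => e _.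
by split=> [[? []]|[]].
Qed.

Lemma dfn_scons Q : dfn Q -> dfn (fun e => exists2 x, M x & Q (scons x e)).
Proof.
move=> [phi [t [tM h]]].
(* Every variable assigned to context variable 0, and there may be several, becomes the bound one;
   the others move up by one. *)
exists (fEx (ren (fun i => if t i is inl 0 then 0 else i.+1) phi)).
exists (fun i => match t i with inl j => inl j.-1 | inr v => inr v end); split.
  by move=> i v; case E: (t i) => [//|w] [<-]; exact: tM E.
move=> e eM /=; split=> -[x Mx hx]; exists x => //; move: hx.
- rewrite h; last exact: inM_scons.
  rewrite sat_ren; congr (sat M phi _); apply/funext => i; rewrite /asg.
  by case E: (t i) => [[|j]|v] //=; rewrite E.
- rewrite h; last exact: inM_scons.
  rewrite sat_ren; congr (sat M phi _); apply/funext => i; rewrite /asg.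
  by case E: (t i) => [[|j]|v] //=; rewrite E.
Qed.

Lemma dfn_ex Q : dfn (fun e => Q (e 0) (fun i => e i.+1)) ->
  dfn (fun e => exists2 x, M x & Q x e).
Proof. by move/dfn_scons. Qed.

Lemma dfn_or Q Q' : dfn Q -> dfn Q' -> dfn (fun e => Q e \/ Q' e).
Proof.
move=> q q'; apply: (dfn_iff _ (dfn_not (dfn_and (dfn_not q) (dfn_not q')))).
by move=> e _; rewrite not_andE !notE.
Qed.

Lemma dfn_imp Q Q' : dfn Q -> dfn Q' -> dfn (fun e => Q e -> Q' e).
Proof.
move=> q q'; apply: (dfn_iff _ (dfn_or (dfn_not q) q')) => e _.
by rewrite implyE.
Qed.

Lemma dfn_equiv Q Q' : dfn Q -> dfn Q' -> dfn (fun e => Q e <-> Q' e).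
Proof. by move=> q q'; apply: dfn_and; apply: dfn_imp. Qed.

Lemma dfn_all Q : dfn (fun e => Q (e 0) (fun i => e i.+1)) ->
  dfn (fun e => forall x, M x -> Q x e).
Proof.
move=> q; have /dfn_not := @dfn_ex (fun x e => ~ Q x e) (dfn_not q).
apply: dfn_iff => e _; split=> [h x Mx|h [x Mx]]; last by apply; exact: h.
by apply: contrapT => n; apply: h; exists x.
Qed.

Lemma dfn_ren Q r : dfn Q -> dfn (fun e => Q (fun i => e (r i))).
Proof.
move=> [phi [t [tM h]]]; exists phi.
exists (fun i => match t i with inl j => inl (r j) | inr v => inr v end); split.
  by move=> i v; case E: (t i) => [//|w] [<-]; exact: tM E.
move=> e eM; rewrite h; last by move=> i.
suff -> : asg t (fun i => e (r i)) = asg (fun i =>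
  match t i with inl j => inl (r j) | inr v => inr v end) e by [].
by apply/funext => i; rewrite /asg; case: (t i).
Qed.

Lemma dfn_vmem i j : dfn (fun e => mem (e i) (e j)).
Proof.
exists (fMem 0 1), (fun k => inl (if k == 0 then i else j)).
by split=> // k v.
Qed.

Lemma dfn_veq i j : dfn (fun e => e i = e j).
Proof.
exists (fEq 0 1), (fun k => inl (if k == 0 then i else j)).
by split=> // k v.
Qed.

Lemma dfnf_var i : dfnf (fun e => e i).
Proof. by split=> [e h|]; [exact: h|exact: dfn_veq]. Qed.

Lemma dfnf_const v : M v -> dfnf (fun=> v).
Proof.
move=> Mv; split=> //.
exists (fEq 0 1), (fun k => if k == 0 then inl 0 else inr v).
by split=> // -[|k] w //= [<-].
Qed.

Lemma dfnf_ren h r : dfnf h -> dfnf (fun e => h (fun i => e (r i))).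
Proof.
move=> [hM hd]; split=> [e eM|]; first by apply: hM.
exact: (@dfn_ren (fun e => e 0 = h (fun i => e i.+1)) (up r)).
Qed.

Definition simple (h : (nat -> V) -> V) : Prop :=
  (exists j, h = fun e => e j) \/ (exists2 v, M v & h = fun=> v).

(** Terms are eliminated one at a time by quantifying over their value. Once all are variables or
    constants, an assignment expresses them. *)
Lemma dfn_sat phi hs k : (forall i, dfnf (hs i)) ->
  (forall i, k <= i -> simple (hs i)) -> dfn (fun e => sat M phi (fun i => hs i e)).
Proof.
elim: k hs => [|k IH] hs hd hk.
  have /choice[t tP] i : exists ti : nat + V,
      hs i = (fun e => match ti with inl j => e j | inr v => v end) /\
      forall v, ti = inr v -> M v.
    have [[j ->]|[v Mv ->]] := hk i (leq0n i); first by exists (inl j).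
    by exists (inr v); split=> // _ [<-].
  exists phi, t; split=> [i v tiv|e _]; first exact: (tP i).2.
  suff -> : (fun i => hs i e) = asg t e by [].
  by apply/funext => i; rewrite (tP i).1.
(* The term at index [k] becomes the newly quantified variable, and the others skip over it. *)
pose hs' i := if i == k then (fun e => e 0)
              else (fun e : nat -> V => hs i (fun j => e j.+1)).
have hd' i : dfnf (hs' i).
  by rewrite /hs'; case: eqP => _; [exact: dfnf_var|exact: dfnf_ren].
have hk' i : k <= i -> simple (hs' i).
  rewrite leq_eqVlt /hs' eq_sym; case: eqP => [_ _|_ /= /hk]; first by left; exists 0.
  by move=> [[j ->]|[v Mv ->]]; [left; exists j.+1|right; exists v].
have := dfn_scons (dfn_and (hd k).2 (IH _ hd' hk')).
apply: dfn_iff => e eM.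
have E x : x = hs k e -> (fun i => hs' i (scons x e)) = (fun i => hs i e).
  by move=> xe; apply/funext => i; rewrite /hs'; case: eqP => [->|].
split=> [[x Mx [/= xe]]|h]; first by rewrite E.
by exists (hs k e); [exact: (hd k).1|split=> //; rewrite E].
Qed.

Lemma dfn_subst Q hs : dfn Q -> (forall i, dfnf (hs i)) ->
  dfn (fun e => Q (fun i => hs i e)).
Proof.
move=> [phi [t [tM h]]] hd; have [k fv] := fv_below_ex phi.
(* Indices from [k] on do not occur in [phi]; they receive a variable so that [dfn_sat] applies. *)
pose us i := if i < k then
    match t i with inl j => hs j | inr v => fun=> v end else fun e => e 0.
have ud i : dfnf (us i).
  rewrite /us; case: ifP => _; last exact: dfnf_var.
  by case E: (t i) => [j|v]; [exact: hd|apply: dfnf_const; exact: tM E].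
have : dfn (fun e => sat M phi (fun i => us i e)).
  apply: (@dfn_sat _ _ k) => // i ki; left; exists 0.
  by rewrite /us ltnNge ki.
apply: dfn_iff => e eM; rewrite h; last by move=> i; apply: (hd i).1.
apply: sat_fv fv _ => i ik; rewrite /us ik /asg; by case: (t i).
Qed.

Definition drel1 (R : V -> Prop) := dfn (fun e => R (e 0)).
Definition drel2 (R : V -> V -> Prop) := dfn (fun e => R (e 0) (e 1)).
Definition drel3 (R : V -> V -> V -> Prop) := dfn (fun e => R (e 0) (e 1) (e 2)).
Definition dfun1 (h : V -> V) := dfnf (fun e => h (e 0)).
Definition dfun2 (h : V -> V -> V) := dfnf (fun e => h (e 0) (e 1)).

Lemma dfn_rel1 R a : drel1 R -> dfnf a -> dfn (fun e => R (a e)).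
Proof. by move=> Rd ad; apply: (@dfn_subst _ (fun=> a) Rd). Qed.

Lemma dfn_rel2 R a b : drel2 R -> dfnf a -> dfnf b -> dfn (fun e => R (a e) (b e)).
Proof.
move=> Rd ad bd; apply: (@dfn_subst _ (fun i => if i is 0 then a else b) Rd).
by case.
Qed.

Lemma dfn_rel3 R a b c : drel3 R -> dfnf a -> dfnf b -> dfnf c ->
  dfn (fun e => R (a e) (b e) (c e)).
Proof.
move=> Rd ad bd cd.
by apply: (@dfn_subst _ (fun i => match i with 0 => a | 1 => b | _ => c end) Rd) => -[|[]].
Qed.

Lemma dfn_mem a b : dfnf a -> dfnf b -> dfn (fun e => mem (a e) (b e)).
Proof. exact/dfn_rel2/dfn_vmem. Qed.

Lemma dfn_eq a b : dfnf a -> dfnf b -> dfn (fun e => a e = b e).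
Proof. exact/(@dfn_rel2 (fun x y => x = y))/dfn_veq. Qed.

Lemma dfnf_subst h hs : dfnf h -> (forall i, dfnf (hs i)) ->
  dfnf (fun e => h (fun i => hs i e)).
Proof.
move=> [hM hd] hsd; split=> [e eM|].
  by apply: hM => i; apply: (hsd i).1.
apply: (@dfn_subst _ (fun i => if i is j.+1 then fun e => hs j (fun i => e i.+1)
                         else fun e => e 0) hd) => -[|i]; first exact: dfnf_var.
exact: dfnf_ren.
Qed.

Lemma dfnf_fun1 h a : dfun1 h -> dfnf a -> dfnf (fun e => h (a e)).
Proof. by move=> hd ad; apply: (@dfnf_subst _ (fun=> a) hd). Qed.

Lemma dfnf_fun2 h a b : dfun2 h -> dfnf a -> dfnf b -> dfnf (fun e => h (a e) (b e)).
Proof.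
move=> hd ad bd; apply: (@dfnf_subst _ (fun i => if i is 0 then a else b) hd).
by case.
Qed.

Lemma dfun1_M h x : dfun1 h -> M x -> M (h x).
Proof. by move=> [hM _] Mx; apply: (hM (fun=> x)). Qed.

Lemma dfun2_M h x y : dfun2 h -> M x -> M y -> M (h x y).
Proof. by move=> [hM _] Mx My; apply: (hM (fun i => if i is 0 then x else y)) => -[]. Qed.

Lemma dfn_env Q n e0 : dfn Q -> inM e0 -> exists phi c, inM c /\
  forall s, size s = n -> (forall x, x \in s -> M x) ->
    (Q (env s e0) <-> sat M phi (env s c)).
Proof.
move=> [phi [t [tM h]]] e0M.
(* Variable [i] of [phi] either stays among the [n] arguments or becomes the parameter at position
   [i], read as variable [n + i]. *)
exists (ren (fun i => match t i with
   | inl j => if j < n then j else n + i | inr _ => n + i end) phi).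
exists (fun i => match t i with inl j => e0 (j - n) | inr v => v end); split.
  by move=> i; case E: (t i) => [j|v]; [exact: e0M|exact: tM E].
move=> s sn sM; rewrite h; last exact: env_M.
rewrite sat_ren; suff -> : asg t (env s e0) =
  (fun i => env s (fun i => match t i with inl j => e0 (j - n) | inr v => v end)
     (match t i with
      | inl j => if j < n then j else n + i | inr _ => n + i end)) by [].
apply/funext => i; rewrite /asg; case E: (t i) => [j|v].
- rewrite !(env_nth _ _ emptyset) sn; case: (ltnP j n) => jn; first by rewrite jn.
  by rewrite ltnNge leq_addr /= addKn E.
- by rewrite (env_nth _ _ emptyset) sn ltnNge leq_addr /= addKn E.
Qed.

Lemma definable_dfn n R e0 Q : inM e0 -> dfn Q ->
  (forall s, R s <-> [/\ size s = n, (forall x, x \in s -> M x) & Q (env s e0)]) ->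
  definable M n R.
Proof.
move=> e0M Qd RP; have [phi [c [cM h]]] := dfn_env n Qd e0M.
exists phi, c; split=> // s; rewrite RP.
by split=> -[sn sM q]; split=> //; [rewrite -h|rewrite h].
Qed.

Lemma dfn_definable n R : definable M n R -> dfn (fun e => R (mkseq e n)).
Proof.
move=> [phi [c [cM h]]].
exists phi, (fun i => if i < n then inl i else inr (c (i - n))); split.
  by move=> i v; case: ifP => // _ [<-].
move=> e eM; rewrite h size_mkseq.
have -> : env (mkseq e n) c = asg (fun i => if i < n then inl i else inr (c (i - n))) e.
  apply/funext => i; rewrite (env_nth _ _ emptyset) size_mkseq /asg.
  by case: ltnP => // ik; rewrite nth_mkseq.
by split=> [[]//|q]; split=> // x /mapP[i _ ->].
Qed.

Lemma drel1_set A : definable_set M A -> drel1 A.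
Proof. by move=> /dfn_definable. Qed.

Lemma definable_set_M A x : definable_set M A -> A x -> M x.
Proof.
move=> [phi [c [_ h]]] Ax; have /h[_ + _] : [set s | if s is [:: x] then A x else False] [:: x] by [].
by apply; rewrite mem_head.
Qed.

Lemma definable_setI v A : M v -> A `<=` M -> drel1 A -> definable_set M A.
Proof.
move=> Mv AM Ad; apply: (@definable_dfn 1 _ (fun=> v) _ _ Ad) => // -[|x [|y s]] //=.
- by split=> // -[].
- split=> [Ax|[]//]; split=> // y; rewrite inE => /eqP ->; exact: AM.
- by split=> // -[].
Qed.

Lemma drel2_rel A R : definable_rel M A R -> drel2 (fun x y => [/\ A x, A y & R x y]).
Proof. by move=> /dfn_definable. Qed.

End Formulas.

(** Definability goals are solved by recursion on their shape; named predicates and operations are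
    looked up in the hint database [dfn]. *)
Ltac dfn_step :=
  lazymatch goal with
  | |- dfn ?M (fun e => @?A e <-> @?B e) => refine (@dfn_equiv M A B _ _)
  | |- dfn ?M (fun e => @?A e /\ @?B e) => refine (@dfn_and M A B _ _)
  | |- dfn ?M (fun e => [/\ @?A e, @?B e & @?C e]) => refine (@dfn_and3 M A B C _ _ _)
  | |- dfn ?M (fun e => @?A e \/ @?B e) => refine (@dfn_or M A B _ _)
  | |- dfn ?M (fun e => ~ @?A e) => refine (@dfn_not M A _)
  | |- dfn ?M (fun e => exists2 x, ?M x & @?Q e x) =>
      refine (@dfn_ex M (fun x e => Q e x) _)
  | |- dfn ?M (fun e => forall x, ?M x -> @?Q e x) =>
      refine (@dfn_all M (fun x e => Q e x) _)
  | |- dfn ?M (fun e => @?A e -> @?B e) => refine (@dfn_imp M A B _ _)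
  | |- dfn ?M (fun e => mem (@?a e) (@?b e)) => refine (@dfn_mem M a b _ _)
  | |- dfn ?M (fun e => @?a e = @?b e :> V) => refine (@dfn_eq M a b _ _)
  | |- dfnf ?M (fun e => e ?i) => exact (dfnf_var M i)
  | |- dfn ?M _ =>
    match goal with
    | |- dfn ?M (fun e => ?R (@?a e) (@?b e) (@?c e)) =>
      refine (@dfn_rel3 M R a b c _ _ _ _); [solve [eauto with dfn] | ..]
    | |- dfn ?M (fun e => ?R (@?a e) (@?b e)) =>
      refine (@dfn_rel2 M R a b _ _ _); [solve [eauto with dfn] | ..]
    | |- dfn ?M (fun e => ?R (@?a e)) =>
      refine (@dfn_rel1 M R a _ _); [solve [eauto with dfn] | ..]
    | _ => solve [eauto with dfn]
    end
  | |- dfnf ?M _ =>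
    match goal with
    | |- dfnf ?M (fun _ => ?v) => apply: (@dfnf_const M v); solve [eauto with dfn]
    | |- dfnf ?M (fun e => ?h (@?a e) (@?b e)) =>
      refine (@dfnf_fun2 M h a b _ _ _); [solve [eauto with dfn] | ..]
    | |- dfnf ?M (fun e => ?h (@?a e)) =>
      refine (@dfnf_fun1 M h a _ _); [solve [eauto with dfn] | ..]
    | _ => solve [eauto with dfn]
    end
  end; cbv beta.

Ltac dfn := rewrite ?/drel1 ?/drel2 ?/drel3 ?/dfun1 ?/dfun2; cbv beta; repeat dfn_step.

Create HintDb dfn.

(** * Set operations as terms definable over the model *)

Section Closure.
Variables (M : set V) (M_ZF : ZFminus M) (M_tr : is_transitive M).

Lemma memM x y : M y -> mem x y -> M x.
Proof. exact: M_tr. Qed.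

Lemma M_emptyset : M emptyset.
Proof.
have [x [Mx [o [Mo _ h]] _]] := ax_infinity M_ZF.
suff -> : emptyset = o by [].
apply: V_extensionality => z; split=> [/mem_emptyset//|zo].
by case: (h z (memM Mo zo)).
Qed.

Lemma M_upair x y : M x -> M y -> M (upair x y).
Proof.
move=> Mx My; have [z Mz h] := ax_pairing M_ZF Mx My.
suff -> : upair x y = z by [].
apply: V_extensionality => w; rewrite mem_upair; split=> [wxy|wz].
  by apply/h => //; case: wxy => ->.
by apply/h => //; exact: memM wz.
Qed.

Lemma M_cup x : M x -> M (cup x).
Proof.
move=> Mx; have [u Mu h] := ax_union M_ZF Mx.
suff -> : cup x = u by [].
apply: V_extensionality => z; rewrite mem_cup; split=> [[y yx zy]|zu].
  have My := memM Mx yx; apply/h; first exact: memM zy.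
  by exists y.
by have /h[|y [_ yx zy]] := zu; [exact: memM zu|exists y].
Qed.

Lemma M_pair x y : M x -> M y -> M (pair x y).
Proof. by move=> Mx My; do !apply: M_upair. Qed.

Lemma M_pairl x y : M (pair x y) -> M x.
Proof.
move=> h; apply: (@memM _ (sing x)); last exact/mem_sing.
by apply: (memM h); apply/mem_upair; left.
Qed.

Lemma M_pairr x y : M (pair x y) -> M y.
Proof.
move=> h; apply: (@memM _ (upair x y)); last by apply/mem_upair; right.
by apply: (memM h); apply/mem_upair; right.
Qed.

Lemma M_sep Q a e : dfn M (fun e => Q (e 0) (fun i => e i.+1)) -> inM M e ->
  M a -> M (sep a (fun z => Q z e)).
Proof.
move=> Qd eM Ma; have [phi [c [cM h]]] := dfn_env 1 Qd eM.
have [b Mb hb] := ax_separation M_ZF phi cM Ma.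
suff -> : sep a (Q^~ e) = b by [].
have E x : M x -> (Q x e <-> sat M phi (env [:: x] c)).
  by move=> Mx; rewrite -h // => y; rewrite inE => /eqP ->.
apply: V_extensionality => z; rewrite mem_sep; split=> [[za Qz]|zb].
  by have Mz := memM Ma za; apply/hb => //; rewrite -E.
by have Mz := memM Mb zb; move: zb; rewrite hb // -E.
Qed.

Lemma M_collection Q a e :
  dfn M (fun e => Q (e 0) (e 1) (fun i => e i.+2)) -> inM M e -> M a ->
  (forall x, mem x a -> exists2 y, M y & Q x y e) ->
  exists2 b, M b & forall x, mem x a -> exists2 y, mem y b & Q x y e.
Proof.
move=> Qd eM Ma ha; have [phi [c [cM h]]] := dfn_env 2 Qd eM.
have E x y : M x -> M y -> (Q x y e <-> sat M phi (env [:: x; y] c)).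
  by move=> Mx My; rewrite -h // => z; rewrite !inE => /orP[]/eqP ->.
have [|b Mb hb] := ax_collection M_ZF cM Ma (phi := phi).
  by move=> x Mx xa; have [y My q] := ha x xa; exists y => //; rewrite -E.
exists b => // x xa; have Mx := memM Ma xa.
by have [y [My yb]] := hb x Mx xa; exists y => //; rewrite E.
Qed.

(** As [M] is transitive, extensionality need only be tested on members in [M], so a definition of
    membership in the value yields one of the value. *)
Lemma dfnf_ext h : (forall e, inM M e -> M (h e)) ->
  dfn M (fun e => mem (e 0) (h (fun i => e i.+1))) -> dfnf M h.
Proof.
move=> hM hd; split=> //.
have hd' := @dfn_ren M _ (fun i => if i is j.+1 then j.+2 else 0) hd.
have : dfn M (fun e => forall z, M z -> (mem z (e 0) <-> mem z (h (fun i => e i.+1)))).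
  apply: (@dfn_all M (fun z e => mem z (e 0) <-> mem z (h (fun i => e i.+1)))).
  by apply: dfn_equiv => //; dfn.
apply: dfn_iff => e eM; split=> [E|-> //].
have Mh : M (h (fun i => e i.+1)) by apply: hM => i.
apply: V_extensionality => z; split=> zh; apply/E => //; apply: memM zh => //.
Qed.

Lemma dfnf_sep Q a : dfn M (fun e => Q (e 0) (fun i => e i.+1)) -> dfnf M a ->
  dfnf M (fun e => sep (a e) (fun z => Q z e)).
Proof.
move=> Qd ad; apply: dfnf_ext => [e eM|]; first exact/M_sep/ad.1.
apply: (@dfn_iff _ (fun e => mem (e 0) (a (fun i => e i.+1)) /\ Q (e 0) (fun i => e i.+1))).
  by move=> e _; rewrite mem_sep.
apply: dfn_and => //; apply: dfn_mem; first exact: dfnf_var.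
exact: (dfnf_ren S ad).
Qed.

Lemma dfn_ex_mem Q a : dfn M (fun e => Q (e 0) (fun i => e i.+1)) -> dfnf M a ->
  dfn M (fun e => exists2 x, mem x (a e) & Q x e).
Proof.
move=> Qd ad.
have := @dfn_ex M (fun x e => mem x (a e) /\ Q x e)
  (dfn_and (dfn_mem (dfnf_var M 0) (dfnf_ren S ad)) Qd).
apply: dfn_iff => e eM; split=> [[x _ []]|[x xa]]; first by exists x.
by exists x => //; apply: memM xa; apply: ad.1.
Qed.

Lemma dfn_all_mem Q a : dfn M (fun e => Q (e 0) (fun i => e i.+1)) -> dfnf M a ->
  dfn M (fun e => forall x, mem x (a e) -> Q x e).
Proof.
move=> Qd ad; have /dfn_not := @dfn_ex_mem (fun x e => ~ Q x e) a (dfn_not Qd) ad.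
apply: dfn_iff => e _; split=> [h x xa|h [x xa]]; last by apply; exact: h.
by apply: contrapT => n; apply: h; exists x.
Qed.

Lemma dfnf_img F a : dfnf M (fun e => F (e 0) (fun i => e i.+1)) -> dfnf M a ->
  dfnf M (fun e => img (fun x => F x e) (a e)).
Proof.
move=> Fd ad.
have Gd : dfn M (fun e => e 1 = F (e 0) (fun i => e i.+2)).
  apply: dfn_eq; first exact: dfnf_var.
  exact: (dfnf_ren (fun i => if i is j.+1 then j.+2 else 0) Fd).
have Hd : dfn M (fun e => exists2 x, mem x (a (fun i => e i.+1)) & e 0 = F x (fun i => e i.+1)).
  apply: (@dfn_ex_mem (fun x e => e 0 = F x (fun i => e i.+1)) (fun e => a (fun i => e i.+1))) => //.
  exact: dfnf_ren S ad.
apply: dfnf_ext => [e eM|]; last first.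
  apply: dfn_iff Hd => e eM; rewrite mem_img.
  by split=> -[x xa h]; exists x.
have Ma := ad.1 e eM.
(* Collection bounds the image by a set in [M], from which Separation cuts it out. *)
have [x xa|b Mb hb] := @M_collection (fun x y e => y = F x e) _ _ Gd eM Ma.
  exists (F x e) => //; apply: (Fd.1 (scons x e)); apply: inM_scons => //.
  exact: memM xa.
have := @M_sep (fun y e => exists2 x, mem x (a e) & y = F x e) b e Hd eM Mb.
set s := sep _ _; suff -> : img (F^~ e) (a e) = s by [].
apply: V_extensionality => z; rewrite mem_img mem_sep; split=> [[x xa <-]|[_ [x xa ->]]].
  by split; [have [y yb <-] := hb x xa|exists x].
by exists x.
Qed.

Lemma dfnf_the Q : (forall e x, inM M e -> Q x e -> M x) ->
  (forall e x y, inM M e -> Q x e -> Q y e -> x = y) ->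
  dfn M (fun e => Q (e 0) (fun i => e i.+1)) ->
  dfnf M (fun e => the (fun x => Q x e)).
Proof.
move=> QM Qu Qd; split=> [e eM|].
  have [[x Qx]|/the_none ->] := pselect (exists x, Q x e); last exact: M_emptyset.
  by apply: (QM e) => //; exact: (@the_spec (Q^~ e) x).
have Rd := @dfn_ren M _ (fun i => if i is j.+1 then j.+2 else 0) Qd.
have := dfn_or Qd (dfn_and (dfn_not (@dfn_ex M (fun x e => Q x (fun i => e i.+1)) Rd))
   (dfn_eq (dfnf_var M 0) (dfnf_const M_emptyset))).
apply: dfn_iff => e eM /=.
have [[x Qx]|/[dup] n /the_none ->] := pselect (exists x, Q x (fun i => e i.+1)).
  have Q0 := @the_spec (Q^~ (fun i => e i.+1)) x Qx.
  split=> [[q|[]]|->]; last by left.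
    by apply: Qu Q0.
  by case; exists x => //; apply: QM Qx.
split=> [[q|[]//]|->]; first by case: n; exists (e 0).
by right; split=> // -[x _ Qx]; apply: n; exists x.
Qed.

Lemma dfun1_cup : dfun1 M cup.
Proof.
apply: dfnf_ext => [e eM|]; first exact: M_cup.
apply: (@dfn_iff _ (fun e => exists2 y, M y & mem y (e 1) /\ mem (e 0) y)); last by dfn.
move=> e eM; rewrite mem_cup; split=> [[y _ []]|[y y1 ?]]; first by exists y.
by exists y => //; apply: memM y1.
Qed.

Lemma dfun2_upair : dfun2 M upair.
Proof.
apply: dfnf_ext => [e eM|]; first exact: M_upair.
apply: (@dfn_iff _ (fun e => e 0 = e 1 \/ e 0 = e 2)); last by dfn.
by move=> e eM; rewrite mem_upair.
Qed.

End Closure.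

Ltac dfn_step_set :=
  match goal with
  | zf : ZFminus ?M, tr : is_transitive ?M |- dfnf ?M (fun e => img (@?F e) (@?a e)) =>
    refine (@dfnf_img M zf tr (fun x e => F e x) a _ _)
  | zf : ZFminus ?M, tr : is_transitive ?M |- dfnf ?M (fun e => sep (@?a e) (@?F e)) =>
    refine (@dfnf_sep M zf tr (fun x e => F e x) a _ _)
  | tr : is_transitive ?M |- dfn ?M (fun e => exists2 x, mem x (@?a e) & @?Q e x) =>
    refine (@dfn_ex_mem M tr (fun x e => Q e x) a _ _)
  | tr : is_transitive ?M |- dfn ?M (fun e => forall x, mem x (@?a e) -> @?Q e x) =>
    refine (@dfn_all_mem M tr (fun x e => Q e x) a _ _)
  end; cbv beta.

Ltac dfn ::= rewrite ?/drel1 ?/drel2 ?/drel3 ?/dfun1 ?/dfun2; cbv beta;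
  repeat first [dfn_step_set | dfn_step].

#[local] Hint Resolve dfun1_cup dfun2_upair : dfn.
#[local] Hint Extern 5 => (apply M_emptyset; assumption) : dfn.

Section Closure2.
Variables (M : set V) (M_ZF : ZFminus M) (M_tr : is_transitive M).

Lemma dfun1_sing : dfun1 M sing.
Proof. by rewrite /sing; dfn. Qed.

Lemma dfun2_pair : dfun2 M pair.
Proof. by rewrite /pair; dfn. Qed.

Lemma dfun2_cup2 : dfun2 M cup2.
Proof. by rewrite /cup2; dfn. Qed.

#[local] Hint Resolve dfun2_pair : dfn.

Lemma dfun2_prod : dfun2 M prod.
Proof. by rewrite /prod; dfn. Qed.

Lemma dfun1_pfst : dfun1 M pfst.
Proof.
apply: (dfnf_the M_ZF M_tr (Q := fun a e => exists b, e 0 = pair a b)).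
- by move=> e x eM [b /esym E]; move: (eM 0); rewrite -E; apply: M_pairl.
- by move=> e x y _ [b ->] [c /pair_inj[]].
apply: (@dfn_iff _ (fun e => exists2 b, M b & e 1 = pair (e 0) b)); last by dfn.
move=> e eM; split=> [[b _ ->]|[b E]]; first by exists b.
by exists b => //; move: (eM 1); rewrite E; apply: M_pairr.
Qed.

Lemma dfun1_psnd : dfun1 M psnd.
Proof.
apply: (dfnf_the M_ZF M_tr (Q := fun b e => exists a, e 0 = pair a b)).
- by move=> e x eM [b /esym E]; move: (eM 0); rewrite -E; apply: M_pairr.
- by move=> e x y _ [b ->] [c /pair_inj[]].
apply: (@dfn_iff _ (fun e => exists2 b, M b & e 1 = pair b (e 0))); last by dfn.
move=> e eM; split=> [[b _ ->]|[b E]]; first by exists b.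
by exists b => //; move: (eM 1); rewrite E; apply: M_pairl.
Qed.

Lemma dfun2_app : dfun2 M app.
Proof.
apply: (dfnf_the M_ZF M_tr (Q := fun u e =>
  mem (pair (e 1) u) (e 0) /\ forall v, mem (pair (e 1) v) (e 0) -> v = u)).
- by move=> e x eM [/(memM M_tr (eM 0)) + _]; apply: M_pairr.
- by move=> e x y _ [xe _] [_]; exact.
apply: (@dfn_iff _ (fun e => mem (pair (e 2) (e 0)) (e 1) /\
  forall v, M v -> mem (pair (e 2) v) (e 1) -> v = e 0)); last by dfn.
move=> e eM; split=> [[h u]|[h u]]; split=> // v; last by move=> _; exact: u.
move=> vf; apply: u => //; exact: M_pairr (memM M_tr (eM 1) vf).
Qed.

End Closure2.

#[local] Hint Resolve dfun1_sing dfun2_pair dfun2_cup2 dfun2_prod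
  dfun1_pfst dfun1_psnd dfun2_app : dfn.

(** * Well-founded recursion over the model *)

Definition graph (g : V -> V) (s : V) : V := img (fun y => pair y (g y)) s.

Lemma mem_graph w g s : mem w (graph g s) <-> exists2 y, mem y s & pair y (g y) = w.
Proof. exact: mem_img. Qed.

Lemma app_graph g s y : mem y s -> app (graph g s) y = g y.
Proof.
move=> ys; apply: app_eq => [v /mem_graph[z _ /pair_inj[-> //]]|].
by apply/mem_graph; exists y.
Qed.

Section Recursion.
Variables (pr : V -> V) (F : V -> V -> V).
Hypothesis wf : well_founded (fun y x => mem y (pr x)).

(** [F] receives the earlier values as a set, their graph, so that definability of [F] over [M]
    makes sense. The default [emptyset] never enters the graph over [pr x]. *)
Definition wfrec : V -> V := Fix wf (fun=> V) (fun x r =>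
  F x (graph (fun y => if pselect (mem y (pr x)) is left h then r y h
                       else emptyset) (pr x))).

Lemma wfrecE x : wfrec x = F x (graph wfrec (pr x)).
Proof.
rewrite {1}/wfrec Fix_eq => [|{}x f g fg]; last first.
  by congr (F x (graph _ _)); apply/funext => y; case: pselect.
congr (F x _); apply: V_extensionality => w; rewrite !mem_graph.
by split=> -[y yx <-]; exists y => //; case: pselect.
Qed.

Variables (M : set V) (M_ZF : ZFminus M) (M_tr : is_transitive M).
Hypotheses (prd : dfun1 M pr) (Fd : dfun2 M F).
Variable g : V -> V.
Hypothesis gE : forall x, g x = F x (graph g (pr x)).

(** [F] must see the values at predecessors only, while an attempt may contain others. *)
Definition restr (f y : V) : V := sep f (fun v => mem (pfst v) (pr y)).

(* [attempt] is the first-order description of the sets satisfying [good]. *)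
Definition attempt (f : V) : Prop := forall w, mem w f ->
  w = pair (pfst w) (psnd w) /\
  ((forall y, mem y (pr (pfst w)) -> exists2 v, mem v f & pfst v = y) /\
   psnd w = F (pfst w) (restr f (pfst w))).

Definition good (f : V) : Prop := forall w, mem w f ->
  exists2 y, w = pair y (g y) & forall z, mem z (pr y) -> mem (pair z (g z)) f.

Lemma good_attempt f : good f -> attempt f.
Proof.
move=> gf w wf'; have [y -> h] := gf w wf'.
rewrite pfst_pair psnd_pair; split=> //; split=> [z /h ?|].
  by exists (pair z (g z)) => //; rewrite pfst_pair.
rewrite gE; congr (F y _); apply: V_extensionality => v; rewrite mem_graph mem_sep.
split=> [[z zy <-]|[/gf[z -> _]]]; first by rewrite pfst_pair; auto.
by rewrite pfst_pair => zy; exists z.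
Qed.

Lemma attempt_good f : attempt f -> good f.
Proof.
move=> af.
(* Well-founded induction: the recursion equation leaves no freedom in the values recorded by an
   attempt. *)
have fg y : forall w, mem w f -> pfst w = y -> psnd w = g y.
  elim/(well_founded_ind wf): y => y IH w wf' wy.
  have [E [hy ->]] := af w wf'; rewrite gE wy; congr (F y _); rewrite wy in hy.
  apply: V_extensionality => v; rewrite mem_graph mem_sep.
  split=> [[vf vy]|[z zy <-]].
    by have [/esym + _] := af v vf; rewrite (IH _ vy v) //; exists (pfst v).
  have [u uf uz] := hy z zy; rewrite pfst_pair; split=> //.
  by have [+ _] := af u uf; rewrite uz (IH _ zy u) // => <-.
move=> w wf'; have [E [h _]] := af w wf'.
exists (pfst w); first by rewrite {1}E (fg (pfst w) w).
move=> z /h[v vf vz]; have [+ _] := af v vf.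
by rewrite vz (fg z v) // => <-.
Qed.

Let attempt_dfn : drel1 M attempt.
Proof. by rewrite /drel1 /attempt /restr; dfn. Qed.
#[local] Hint Resolve attempt_dfn : dfn.

(** Good sets are parts of the graph of [g], so unions of them are good. Collection and Separation
    need a definable predicate, hence are applied to [attempt]; the union of the attempts so
    obtained for the predecessors is extended by the pair at [x]. *)
Lemma good_ex x : M x -> exists2 f, M f & good f /\ mem (pair x (g x)) f.
Proof.
elim/(well_founded_ind wf): x => x IH Mx.
have Mp : M (pr x) by exact: (dfun1_M prd Mx).
have Qd : dfn M (fun e => attempt (e 1) /\ exists2 v, mem v (e 1) & pfst v = e 0).
  by dfn.
have [|z zx|b Mb hb] := M_collection M_ZF M_tr
  (Q := fun y f _ => attempt f /\ exists2 v, mem v f & pfst v = y) Qd (e := fun=> x) _ Mp.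
- by move=> i.
- have [f Mf [gf zf]] := IH z zx (memM M_tr Mp zx).
  exists f => //; split; first exact: good_attempt.
  by exists (pair z (g z)) => //; rewrite pfst_pair.
pose f0 := cup (sep b attempt).
have Mf0 : M f0.
  apply: M_cup => //; apply: (@M_sep _ M_ZF M_tr (fun z _ => attempt z) b (fun=> x)) => //.
have f0P v : mem v f0 <-> exists2 f, mem f b /\ good f & mem v f.
  rewrite mem_cup; split=> -[f].
    by move=> /mem_sep[fb /attempt_good gf vf]; exists f.
  by move=> [fb /good_attempt af] vf; exists f => //; apply/mem_sep.
have xf0 z : mem z (pr x) -> mem (pair z (g z)) f0.
  move=> /hb[f fb [/attempt_good gf [v vf <-]]]; apply/f0P; exists f => //.
  by have [y E _] := gf v vf; move: vf; rewrite E pfst_pair.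
have gf0 : good f0.
  move=> v /f0P[f [fb gf] /gf[y -> h]]; exists y => // z /h zf.
  by apply/f0P; exists f.
have Mg : M (g x).
  rewrite gE; suff -> : graph g (pr x) = restr f0 x.
    apply: (dfun2_M Fd Mx).
    apply: (@M_sep _ M_ZF M_tr (fun v e => mem (pfst v) (pr (e 0))) f0 (fun=> x)) => //.
    by dfn.
  apply: V_extensionality => v; rewrite mem_graph mem_sep.
  split=> [[z zx <-]|[/gf0[z -> _]]]; first by rewrite pfst_pair; auto.
  by rewrite pfst_pair; exists z.
exists (cup2 f0 (sing (pair x (g x)))).
  apply: M_cup => //; apply: M_upair => //; apply: M_upair => //; exact: M_pair.
split; last by apply/mem_cup2; right; apply/mem_sing.
move=> w /mem_cup2[/gf0[y -> h]|/mem_sing ->].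
  by exists y => // z /h zf; apply/mem_cup2; left.
by exists x => // z /xf0 zf; apply/mem_cup2; left.
Qed.

Lemma dfun1_rec : dfun1 M g.
Proof.
split=> [e eM|].
  have [f Mf [_ /(memM M_tr Mf)]] := good_ex (eM 0); exact: M_pairr.
apply: (@dfn_iff _ (fun e => exists2 f, M f & attempt f /\ mem (pair (e 1) (e 0)) f)).
  move=> e eM; split=> [[f Mf [/attempt_good gf /gf[y /pair_inj[-> ->]]]] //|->].
  have [f Mf [gf h]] := good_ex (eM 1); exists f => //; split=> //.
  exact: good_attempt.
by dfn.
Qed.

End Recursion.

(** * Names *)

Definition nmdom (x : V) : V := img pfst x.

Lemma mem_nmdom a x : mem a (nmdom x) <-> exists2 w, mem w x & pfst w = a.
Proof. exact: mem_img. Qed.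

(** The recursion on names is set up for arbitrary sets. An element that is not a pair contributes
    the default [emptyset], which is accessible because it has no predecessors. *)
Lemma nmdom_wf : well_founded (fun a x => mem a (nmdom x)).
Proof.
have A0 : Acc (fun a x => mem a (nmdom x)) emptyset.
  by constructor=> y /mem_nmdom[w /mem_emptyset].
move=> x; elim/(well_founded_ind name_lt_wf): x => x IH.
constructor=> _ /mem_nmdom[w wx <-].
have [[a [b E]]|n] := pselect (exists a b, w = pair a b); last first.
  by rewrite (_ : pfst w = emptyset) //; apply: the_none => -[a h]; apply: n; exists a.
by apply: IH; exists b; rewrite E pfst_pair -E.
Qed.

(** Recursions with two arguments run on coded pairs and descend in the first component. *)
Lemma wf_pfst (pr : V -> V) :
  (forall y z, mem y (pr z) -> mem (pfst y) (nmdom (pfst z))) ->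
  well_founded (fun y z => mem y (pr z)).
Proof.
move=> h; apply: wf_incl (wf_inverse_image _ _ _ pfst nmdom_wf).
by move=> y z /h.
Qed.

Section Names.
Variables (M : set V) (M_ZF : ZFminus M) (M_tr : is_transitive M).
Variables (P : porder) (Pd : drel1 M (dom P)).
#[local] Hint Resolve Pd : dfn.

Lemma dfun1_nmdom : dfun1 M nmdom.
Proof. by rewrite /nmdom; dfn. Qed.
#[local] Hint Resolve dfun1_nmdom : dfn.

(* The characteristic function of [is_name P], with [emptyset] a member of
   the value exactly on names. *)
Definition nm_step (x f : V) : V := sep (sing emptyset) (fun _ =>
  forall w, mem w x -> [/\ w = pair (pfst w) (psnd w),
    mem emptyset (app f (pfst w)) & dom P (psnd w)]).

Definition nm : V -> V := wfrec nm_step nmdom_wf.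

Lemma nmP x : mem emptyset (nm x) <-> is_name P x.
Proof.
elim/(well_founded_ind nmdom_wf): x => x IH.
have -> : nm x = nm_step x (graph nm (nmdom x)) by exact: wfrecE.
rewrite mem_sep; split=> [[_ h]|[h]].
  constructor=> w wx; have [E n Pw] := h w wx; exists (pfst w), (psnd w); split=> //.
  have wn : mem (pfst w) (nmdom x) by apply/mem_nmdom; exists w.
  by apply/(IH _ wn); move: n; rewrite app_graph.
split=> [|w wx]; first exact/mem_sing.
have [a [p [E na Pp]]] := h w wx.
have wn : mem (pfst w) (nmdom x) by apply/mem_nmdom; exists w.
rewrite app_graph // E pfst_pair psnd_pair; split=> //.
by rewrite E pfst_pair in wn; exact/(IH _ wn).
Qed.

Lemma dfun1_nm : dfun1 M nm.
Proof.
apply: (dfun1_rec nmdom_wf M_ZF M_tr dfun1_nmdom (F := nm_step)); last by move=> x; exact: wfrecE.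
rewrite /nm_step /dfun2; apply: (dfnf_sep M_ZF M_tr (Q := fun _ e =>
  forall w, mem w (e 0) -> [/\ w = pair (pfst w) (psnd w),
    mem emptyset (app (e 1) (pfst w)) & dom P (psnd w)])); by dfn.
Qed.
#[local] Hint Resolve dfun1_nm : dfn.

Lemma drel1_names : drel1 M (names M P).
Proof.
apply: (@dfn_iff _ (fun e => mem emptyset (nm (e 0)))); last by dfn.
by move=> e eM; rewrite nmP; split=> [|[]].
Qed.

Lemma names_sub tau p sigma : names M P sigma -> mem (pair tau p) sigma ->
  names M P tau /\ dom P p.
Proof.
move=> [Ms [h]] hs; have [a [q [/pair_inj[E1 E2] na Pq]]] := h _ hs; subst a q.
by split=> //; split=> //; apply: (M_pairl M_tr (memM M_tr Ms hs)).
Qed.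

Lemma names_elt w sigma : names M P sigma -> mem w sigma ->
  w = pair (pfst w) (psnd w).
Proof.
by move=> [Ms [h]] /h[a [q [-> _ _]]]; rewrite pfst_pair psnd_pair.
Qed.

Lemma names_emptyset : names M P emptyset.
Proof. by split; [exact: M_emptyset|constructor=> w /mem_emptyset]. Qed.

End Names.

(** * Generic filters *)

(** An injection of formulas into a countable type, through which they are numbered by [pickle]. *)
Fixpoint formula_tree (phi : formula) : GenTree.tree nat :=
  match phi with
  | fMem i j => GenTree.Node 0 [:: GenTree.Leaf i; GenTree.Leaf j]
  | fEq i j => GenTree.Node 1 [:: GenTree.Leaf i; GenTree.Leaf j]
  | fNot psi => GenTree.Node 2 [:: formula_tree psi]
  | fAnd psi chi => GenTree.Node 3 [:: formula_tree psi; formula_tree chi]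
  | fEx psi => GenTree.Node 4 [:: formula_tree psi]
  end.

Lemma formula_tree_inj : injective formula_tree.
Proof.
elim=> [i j|i j|psi IH|psi IH chi IH'|psi IH] [k l|k l|psi'|psi' chi'|psi'] //=.
- by case=> -> ->.
- by case=> -> ->.
- by case=> /IH ->.
- by case=> /IH -> /IH' ->.
- by case=> /IH ->.
Qed.

Section Generic.
Variables (M : set V) (M_countable : countable M).

Lemma definable_set_enum :
  exists D : nat -> set V, forall A, definable_set M A -> exists n, D n = A.
Proof.
have /countable_injP[f f_inj] := M_countable.
pose code phi s := pickle (formula_tree phi, map f s).
pose C n (A : set V) := exists phi s, [/\ n = code phi s, (forall x, x \in s -> M x) &
  forall x, A x <-> M x /\ sat M phi (env (x :: s) (fun=> emptyset))].
have C_fun n A A' : C n A -> C n A' -> A = A'.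
  move=> [phi [s [-> sM AP]]] [phi' [s' [/(pcan_inj pickleK)[/formula_tree_inj E fs] s'M A'P]]].
  have ss' : s = s'.
    elim: s s' fs sM s'M {AP A'P} => [|x s IH] [|y s'] //= [fxy fs] sM s'M.
    have Hc (t : seq V) z u : u \in t -> u \in z :: t by rewrite in_cons => ->; rewrite orbT.
    congr cons; last by apply: IH => // u /Hc h; [exact: sM|exact: s'M].
    by apply: f_inj => //; rewrite inE; [apply: sM|apply: s'M]; rewrite mem_head.
  by apply/seteqP; split=> x; rewrite AP A'P E ss'.
exists (fun n => if pselect (exists A, C n A) is left h then sval (cid h) else set0).
move=> A [phi [c [cM h]]]; have [k fv] := fv_below_ex phi.
(* Only variables below [k] occur, so finitely many parameters, coded by a number, determine [A]. *)
have CA : C (code phi (mkseq c k)) A.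
  exists phi, (mkseq c k); split=> // [x /mapP[i _ ->] //|x].
  have E : sat M phi (env [:: x] c) <-> sat M phi (env (x :: mkseq c k) (fun=> emptyset)).
    apply: sat_fv fv _ => -[|i] //= ik; rewrite (env_nth _ _ emptyset) size_mkseq.
    by rewrite (ltnW ik) nth_mkseq // ltnW.
  rewrite -E; have {}h := h [:: x]; split=> [Ax|[Mx sx]].
    by have /h[_ + ?] := Ax; move/(_ x (mem_head _ _)).
  by apply/h; split=> // y; rewrite inE => /eqP ->.
exists (code phi (mkseq c k)); case: pselect => [h'|[]]; last by exists A.
by case: cid => A' /= CA'; exact: C_fun CA' CA.
Qed.

(** The Rasiowa-Sikorski argument: a descending sequence from [p] enters the enumerated definable
    dense sets one after the other and generates the filter. *)
Lemma generic_ex (P : porder) p : dom P p -> exists2 G, generic M P G & G p.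
Proof.
move=> Pp; have [D D_enum] := definable_set_enum.
have next n x : exists y, dom P x -> [/\ dom P y, ple P y x & is_dense P (D n) -> D n y].
  have [Px|] := pselect (dom P x); last by exists x.
  have [h|] := pselect (is_dense P (D n)).
    by have [y Dy yx] := h.2 x Px; exists y; split=> //; exact: h.1.
  by exists x; split=> //; exact: ple_refl.
pose q := fix q n := if n is k.+1 then sval (cid (next k (q k))) else p.
have Pq n : dom P (q n).
  by elim: n => //= n Pn; case: cid => y /= /(_ Pn)[].
have qS n : ple P (q n.+1) (q n) /\ (is_dense P (D n) -> D n (q n.+1)).
  by rewrite /=; case: cid => y /= /(_ (Pq n))[].
have q_le m n : m <= n -> ple P (q n) (q m).
  elim: n => [|n IH]; first by rewrite leqn0 => /eqP ->; exact: ple_refl.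
  rewrite leq_eqVlt => /orP[/eqP ->|/IH h]; first exact: ple_refl.
  exact: ple_trans (qS n).1 h.
exists [set x | dom P x /\ exists n, ple P (q n) x]; last first.
  by split=> //; exists 0; exact: ple_refl.
split; first split.
- by move=> x [].
- by exists p; split=> //; exists 0; exact: ple_refl.
- move=> x y [Px [n nx]] Py xy; split=> //; exists n; exact: ple_trans nx xy.
- move=> x y [Px [n nx]] [Py [m my]]; exists (q (maxn n m)); split.
  + by split=> //; exists (maxn n m); exact: ple_refl.
  + exact: ple_trans (q_le _ _ (leq_maxl n m)) nx.
  + exact: ple_trans (q_le _ _ (leq_maxr n m)) my.
- move=> A dA /D_enum[n E]; exists (q n.+1); split.
  by rewrite -E; apply: (qS n).2; rewrite E.
  by split=> //; exists n.+1; exact: ple_refl.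
Qed.

End Generic.

(** * From a Boolean completion to the forcing theorem *)

Section BooleanAlgebra.
Variable B : boolalg.
Local Notation "a ∧ b" := (bmeet B a b) (at level 40, left associativity).
Local Notation "¬ a" := (bcompl B a) (at level 35).
Local Notation D := (bdom B).
#[local] Hint Resolve bmeet_dom bjoin_dom bcompl_dom bzero_dom : core.

Lemma bmeet_id a : D a -> a ∧ a = a.
Proof. by move=> Da; rewrite -{2}(bjoinK Da Da) bmeetK; auto. Qed.

Lemma ble_antisym a b : D a -> D b -> ble B a b -> ble B b a -> a = b.
Proof. by rewrite /ble => Da Db E1 E2; rewrite -E1 bmeetC. Qed.

Lemma ble_trans a b c : D a -> D b -> D c -> ble B a b -> ble B b c -> ble B a c.
Proof. by rewrite /ble => Da Db Dc ab bc; rewrite -ab -bmeetA // bc. Qed.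

Lemma bmeet_lel a b : D a -> D b -> ble B (a ∧ b) a.
Proof.
by move=> Da Db; rewrite /ble (bmeetC (bmeet_dom Da Db) Da) bmeetA // bmeet_id.
Qed.

Lemma bmeet_ler a b : D a -> D b -> ble B (a ∧ b) b.
Proof. by move=> Da Db; rewrite bmeetC //; exact: bmeet_lel. Qed.

Lemma ble_meet a b c : D a -> D b -> D c -> ble B c a -> ble B c b -> ble B c (a ∧ b).
Proof. by rewrite /ble => Da Db Dc ca cb; rewrite bmeetA // ca cb. Qed.

Lemma ble_zero a : D a -> ble B a (bzero B) -> a = bzero B.
Proof.
move=> Da <-; rewrite -{1}(bmeet_compl Da) bmeetA ?bmeet_id ?bmeet_compl //; auto.
Qed.

(** Distributing [a] over the join of [c] and [b] leaves only the meet of [a] and [c]. The next two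
    lemmas take [c] as the complement of [b], and [b] as that of [c]. *)
Lemma ble_complement a b c : D a -> D b -> D c ->
  bjoin B c b = bone B -> a ∧ b = bzero B -> ble B a c.
Proof.
move=> Da Db Dc cb ab; rewrite /ble.
have Dac : D (a ∧ c) by auto.
have <- : a ∧ bjoin B c b = a ∧ c.
  by rewrite bmeetDr // ab -(bmeet_compl Dac) bjoinK //; auto.
by rewrite cb -(bjoin_compl Da) bmeetK //; auto.
Qed.

Lemma ble_compl a b : D a -> D b -> a ∧ b = bzero B -> ble B a (¬ b).
Proof.
by move=> Da Db; apply: ble_complement; rewrite // 1?bjoinC ?bjoin_compl //; auto.
Qed.

Lemma ble_meet_compl a b : D a -> D b -> a ∧ (¬ b) = bzero B -> ble B a b.
Proof. by move=> Da Db; apply: ble_complement; rewrite ?bjoin_compl //; auto. Qed.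

Lemma ble_compl_zero a b : D a -> D b -> ble B a b -> ble B a (¬ b) -> a = bzero B.
Proof.
move=> Da Db ab ab'; apply: ble_zero => //; rewrite -(bmeet_compl Db).
by apply: ble_meet => //; auto.
Qed.


End BooleanAlgebra.

(** * Density arguments for generic filters *)

Section GenericDensity.
Variables (M : set V) (M_ZF : ZFminus M) (M_tr : is_transitive M) (P : porder).
Hypothesis (Pd : porder_definable M P).

Definition le (p q : V) : Prop := [/\ dom P p, dom P q & ple P p q].

Lemma drel1_dom : drel1 M (dom P).
Proof. exact: drel1_set Pd.1. Qed.

Lemma drel2_le : drel2 M le.
Proof. exact: drel2_rel Pd.2. Qed.

#[local] Hint Resolve drel1_dom drel2_le : dfn.

Lemma dom_M p : dom P p -> M p.
Proof. exact: definable_set_M Pd.1. Qed.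

Lemma le_refl p : dom P p -> le p p.
Proof. by move=> Pp; split=> //; exact: ple_refl. Qed.

Lemma le_trans p q r : le p q -> le q r -> le p r.
Proof. by move=> [Pp Pq pq] [_ Pr qr]; split=> //; exact: ple_trans pq qr. Qed.

Lemma filter_le G p q : is_filter P G -> G p -> G q ->
  exists r, [/\ G r, le r p & le r q].
Proof.
move=> Gf Gp Gq; have [r [Gr rp rq]] := filter_directed Gf Gp Gq.
by have s := filter_sub Gf; exists r; do !split=> //; exact: s.
Qed.

Lemma filter_up_le G p q : is_filter P G -> G p -> le p q -> G q.
Proof. by move=> Gf Gp [_ Pq pq]; exact: filter_up Gf _ _ Gp Pq pq. Qed.

(** The conditions that satisfy [Q] or have no extension satisfying it form a definable dense
    set. *)
Lemma generic_decides (Q : V -> Prop) G : drel1 M Q -> generic M P G ->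
  exists2 r, G r & Q r \/ forall q, le q r -> ~ Q q.
Proof.
move=> Qd [Gf Gd].
pose D := [set r | dom P r /\ (Q r \/ forall q, le q r -> ~ Q q)].
have [||r [[_ h] Gr]] := Gd D; last by exists r.
- split=> [x []//|p Pp].
  have [[q [Pq _ qp] Qq]|n] := pselect (exists2 q, le q p & Q q).
    by exists q => //; split=> //; left.
  exists p; last exact: ple_refl.
  by split=> //; right=> q qp Qq; apply: n; exists q.
- apply: (definable_setI (M_emptyset M_ZF M_tr)) => [x [/dom_M]//|].
  apply: (@dfn_iff _ (fun e => dom P (e 0) /\ (Q (e 0) \/ forall q, M q -> le q (e 0) -> ~ Q q))).
    move=> e eM; split=> -[Pe [?|h]]; split=> //; auto.
    by right=> q qe; apply: h => //; case: qe => /dom_M.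
  by dfn.
Qed.

Lemma generic_below (Q : V -> Prop) G p : drel1 M Q -> generic M P G -> G p ->
  (forall q, le q p -> exists2 r, le r q & Q r) -> exists2 r, G r & Q r.
Proof.
move=> Qd Gg Gp h; have [r Gr [Qr|n]] := generic_decides Qd Gg; first by exists r.
have [s [_ sr sp]] := filter_le Gg.1 Gr Gp.
by have [t ts Qt] := h s sp; case: (n t (le_trans ts sr)).
Qed.

End GenericDensity.

Section FromCompletion.
Variables (M : set V) (M_ZF : ZFminus M) (M_tr : is_transitive M) (P : porder).
Hypotheses (M_countable : countable M) (Pd : porder_definable M P).
Variables (B : boolalg) (pi : V -> V).
Hypotheses (Bd : boolalg_definable M B) (Bc : complete_in M B)
  (pi_emb : dense_embedding P B pi) (pid : definable_fun1 M (dom P) pi).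

Let Pdom := drel1_dom Pd.
Let Ple := drel2_le Pd.
#[local] Hint Resolve Pdom Ple : dfn.

(* The operations of [B] and the embedding are only definable on their domain,
   so they are replaced by total functions, with value [emptyset] elsewhere. *)
Definition bm (a b : V) : V := the (fun c => [/\ bdom B a, bdom B b & c = bmeet B a b]).
Definition bc (a : V) : V := the (fun c => bdom B a /\ c = bcompl B a).
Definition emb (p : V) : V := the (fun b => dom P p /\ b = pi p).
Definition bsup (A : V) : V := the (fun s => [/\ bdom B s,
  forall a, mem a A -> bm a s = a &
  forall u, M u -> bdom B u -> (forall a, mem a A -> bm a u = a) -> bm s u = s]).

Lemma bm_eq a b : bdom B a -> bdom B b -> bm a b = bmeet B a b.
Proof. by move=> Da Db; apply: the_eq => // c []. Qed.

Lemma bc_eq a : bdom B a -> bc a = bcompl B a.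
Proof. by move=> Da; apply: the_eq => // c []. Qed.

Lemma emb_eq p : dom P p -> emb p = pi p.
Proof. by move=> Pp; apply: the_eq => // c []. Qed.

Lemma bdom_M a : bdom B a -> M a.
Proof. by case: Bd => h _ _ _ _; exact: definable_set_M h. Qed.

Lemma drel1_bdom : drel1 M (bdom B).
Proof. by case: Bd => h _ _ _ _; exact: drel1_set h. Qed.
#[local] Hint Resolve drel1_bdom : dfn.

Lemma dfun2_bm : dfun2 M bm.
Proof.
apply: (dfnf_the M_ZF M_tr
  (Q := fun c e => [/\ bdom B (e 0), bdom B (e 1) & c = bmeet B (e 0) (e 1)])).
- by move=> e x _ [? ? ->]; apply/bdom_M/bmeet_dom.
- by move=> e x y _ [_ _ ->] [].
- case: Bd => _ /dfn_definable h _ _ _.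
  (* In the graph of an operation the value comes last, whereas [dfnf_the] expects it in variable
     0. *)
  exact: (@dfn_ren M _ (fun i => match i with 0 => 1 | 1 => 2 | _ => 0 end) h).
Qed.

Lemma dfun1_bc : dfun1 M bc.
Proof.
apply: (dfnf_the M_ZF M_tr (Q := fun c e => bdom B (e 0) /\ c = bcompl B (e 0))).
- by move=> e x _ [? ->]; apply/bdom_M/bcompl_dom.
- by move=> e x y _ [_ ->] [].
- case: Bd => _ _ _ /dfn_definable h _.
  exact: (@dfn_ren M _ (fun i => match i with 0 => 1 | _ => 0 end) h).
Qed.

Lemma dfun1_emb : dfun1 M emb.
Proof.
apply: (dfnf_the M_ZF M_tr (Q := fun c e => dom P (e 0) /\ c = pi (e 0))).
- by move=> e x _ [Pe ->]; apply/bdom_M; case: (emb_dom pi_emb Pe).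
- by move=> e x y _ [_ ->] [].
- move: pid => /dfn_definable h.
  exact: (@dfn_ren M _ (fun i => match i with 0 => 1 | _ => 0 end) h).
Qed.
#[local] Hint Resolve dfun2_bm dfun1_bc dfun1_emb : dfn.

Lemma dfun1_bsup : dfun1 M bsup.
Proof.
apply: (dfnf_the M_ZF M_tr (Q := fun s e => [/\ bdom B s,
  forall a, mem a (e 0) -> bm a s = a &
  forall u, M u -> bdom B u -> (forall a, mem a (e 0) -> bm a u = a) -> bm s u = s])).
- by move=> e x _ [/bdom_M].
- move=> e x y _ [Dx ux lx] [Dy uy ly].
  rewrite -(lx _ (bdom_M Dy) Dy uy) -{2}(ly _ (bdom_M Dx) Dx ux).
  by rewrite !bm_eq // bmeetC.
- by dfn.
Qed.
#[local] Hint Resolve dfun1_bsup : dfn.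

(* [star G] is the ultrafilter on [B] generated by [G]. *)
Definition star (G : set V) (b : V) : Prop := exists2 p, G p & ble B (pi p) b.

(** The order between [pi p] and [b], written with the total operations to make it visibly
    definable. *)
Definition below (p b : V) : Prop := [/\ dom P p, bdom B b & bm (emb p) b = emb p].

Lemma belowP p b : dom P p -> bdom B b -> (below p b <-> ble B (pi p) b).
Proof.
move=> Pp Db; have [Dp _] := emb_dom pi_emb Pp.
by rewrite /below emb_eq // bm_eq //; split=> [[]|].
Qed.

Lemma drel2_below : drel2 M below.
Proof. by rewrite /below; dfn. Qed.
#[local] Hint Resolve drel2_below : dfn.

Let pi_dom p : dom P p -> bdom B (pi p).
Proof. by move=> /(emb_dom pi_emb)[]. Qed.

Lemma pi_le p q : le P p q -> ble B (pi p) (pi q).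
Proof. by move=> [Pp Pq]; rewrite (emb_le pi_emb). Qed.

Lemma emb_meet p b : dom P p -> bdom B b -> bmeet B (pi p) b <> bzero B ->
  exists2 q, le P q p & ble B (pi q) b.
Proof.
move=> Pp Db nz; have Dp := pi_dom Pp; have Dm := bmeet_dom Dp Db.
have [q Pq qm] := emb_dense pi_emb Dm nz; have Dq := pi_dom Pq.
exists q; last exact: ble_trans qm (bmeet_ler Dp Db).
split=> //; apply/(emb_le pi_emb) => //.
exact: ble_trans qm (bmeet_lel Dp Db).
Qed.

Lemma below_mono p q b : le P q p -> below p b -> below q b.
Proof.
move=> qp [Pp Db /[dup] _]; have [Pq _ _] := qp => h.
by apply/belowP => //; apply: ble_trans (pi_le qp) _; auto; apply/belowP.
Qed.

(** Otherwise [pi p] meets the complement of [b], so some [q] below [p] lies in that complement, and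
    no extension of [q] is below [b]. *)
Lemma below_dense p b : dom P p -> bdom B b ->
  (forall q, le P q p -> exists2 r, le P r q & below r b) -> below p b.
Proof.
move=> Pp Db h; apply/belowP => //; have Dp := pi_dom Pp.
have Dc := bcompl_dom Db.
have [z|/(emb_meet Pp Dc)[q qp qc]] := pselect (bmeet B (pi p) (bcompl B b) = bzero B).
  exact: ble_meet_compl.
have [r rq /belowP rb] := h q qp; have [Pr Pq _] := rq.
have [Dr nz] := emb_dom pi_emb Pr; case: nz; apply: (ble_compl_zero Dr Db).
  exact: rb.
by apply: ble_trans (pi_le rq) qc; auto.
Qed.

Lemma star_up G b c : G `<=` dom P -> bdom B b -> bdom B c -> ble B b c ->
  star G b -> star G c.
Proof.
move=> GP Db Dc bc' [p Gp pb]; exists p => //.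
by apply: ble_trans pb bc' => //; apply/pi_dom/GP.
Qed.

Lemma star_emb G q : is_filter P G -> dom P q -> (star G (emb q) <-> G q).
Proof.
move=> Gf Pq; rewrite emb_eq //; split=> [[p Gp]|Gq].
  have Pp := filter_sub Gf Gp.
  by rewrite -(emb_le pi_emb) // => pq; exact: filter_up Gf _ _ Gp Pq pq.
by exists q => //; exact/bmeet_id/pi_dom.
Qed.

Lemma star_meet G a b : is_filter P G -> bdom B a -> bdom B b ->
  (star G (bm a b) <-> star G a /\ star G b).
Proof.
move=> Gf Da Db; have GP := filter_sub Gf; have Dm := bmeet_dom Da Db.
rewrite bm_eq //; split=> [s|[[p Gp pa] [q Gq qb]]].
  by split; apply: star_up s => //; [exact: bmeet_lel|exact: bmeet_ler].
have [r [Gr rp rq]] := filter_le Gf Gp Gq; have Dr := pi_dom (GP _ Gr).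
exists r => //; apply: ble_meet => //.
- by apply: ble_trans (pi_le rp) pa => //; exact/pi_dom/GP.
- by apply: ble_trans (pi_le rq) qb => //; exact/pi_dom/GP.
Qed.

(** Some [r] in [G] is below [a] or has no extension below [a]; in the second case density of the
    embedding makes [pi r] disjoint from [a]. *)
Lemma star_compl G a : generic M P G -> bdom B a -> (star G (bc a) <-> ~ star G a).
Proof.
move=> Gg Da; have [Gf _] := Gg; have GP := filter_sub Gf; have Ma := bdom_M Da.
rewrite bc_eq //; split=> [[p Gp pa] [q Gq qa]|n].
  have [r [Gr rp rq]] := filter_le Gf Gp Gq.
  have [Dr nz] := emb_dom pi_emb (GP _ Gr); have Dc := bcompl_dom Da.
  apply: nz; apply: (ble_compl_zero Dr Da).
  - by apply: ble_trans (pi_le rq) qa => //; exact/pi_dom/GP.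
  - by apply: ble_trans (pi_le rp) pa => //; exact/pi_dom/GP.
have Qd : drel1 M (below^~ a) by dfn.
have [r Gr [ra|nr]] := generic_decides M_ZF M_tr Pd Qd Gg.
  by case: n; exists r => //; apply/belowP => //; exact: GP.
have Pr := GP _ Gr; exists r => //; apply: ble_compl => //; first exact: pi_dom.
apply: contrapT => /(emb_meet Pr Da)[q qr qa]; apply: (nr q qr).
by apply/belowP => //; case: qr.
Qed.

Lemma bsup_sup A : M A -> elts A `<=` bdom B -> is_sup B (elts A) (bsup A).
Proof.
move=> MA AB; have [s [Ds us ls]] := Bc MA AB.
suff -> : bsup A = s by [].
apply: the_eq => [t [Dt ut lt]|].
  apply: (@ble_antisym B) => //.
    rewrite /ble -bm_eq //; apply: lt => //; first exact: bdom_M.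
    by move=> a aA; rewrite bm_eq //; [exact: us|exact: AB].
  by apply: ls => // a aA; rewrite /ble -bm_eq //; [exact: ut|exact: AB].
split=> // [a aA|u _ Du h].
  by rewrite bm_eq //; [exact: us|exact: AB].
rewrite bm_eq //; apply: ls => // a aA.
by rewrite /ble -bm_eq //; [exact: h|exact: AB].
Qed.

(** If a condition [q] below the supremum met no member of [A], the complement of [pi q] would bound
    [A] and thus lie above [pi q]. So the conditions below some member of [A] are dense below
    [p]. *)
Lemma star_sup G A : generic M P G -> M A -> elts A `<=` bdom B ->
  (star G (bsup A) <-> exists2 a, mem a A & star G a).
Proof.
move=> Gg MA AB; have [Gf _] := Gg; have GP := filter_sub Gf.
have [Ds us ls] := bsup_sup MA AB; split=> [[p Gp ps]|[a aA]]; last first.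
  by apply: star_up => //; [exact: AB|exact: us].
have Qd : drel1 M (fun q => exists2 a, mem a A & below q a) by dfn.
have [|q Gq [a aA qa]] := generic_below M_ZF M_tr Pd Qd Gg Gp; last first.
  exists a => //; exists q => //; apply/belowP => //; [exact: GP|exact: AB].
move=> q qp; have [Pq Pp _] := qp.
have Dq := pi_dom Pq; have [_ nz] := emb_dom pi_emb Pq.
have qs := ble_trans Dq (pi_dom Pp) Ds (pi_le qp) ps.
have [a aA qa] : exists2 a, mem a A & bmeet B (pi q) a <> bzero B.
  apply: contrapT => n; have Dc := bcompl_dom Dq; apply: nz.
  have sc : ble B (bsup A) (bcompl B (pi q)).
    apply: ls => // a aA; have Da := AB a aA; apply: ble_compl => //.
    rewrite bmeetC //; apply: contrapT => qa; apply: n; by exists a.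
  exact: (ble_compl_zero Dq Dq (bmeet_id Dq) (ble_trans Dq Ds Dc qs sc)).
have [r rq ra] := emb_meet Pq (AB a aA) qa; exists r => //.
by exists a => //; apply/belowP => //; [case: rq|exact: AB].
Qed.

(* The Boolean value of [sigma = tau], by recursion on pairs of names. *)
Definition beq_pr (z : V) : V := prod (nmdom (pfst z)) (nmdom (psnd z)).

(** Extensionality: an element of either name, when its condition holds, belongs to the other. The
    infimum of these implications is the complement of a supremum of counterexamples, as
    completeness provides suprema. *)
Definition beq_step (z f : V) : V :=
  bm (bc (bsup (img (fun w => bm (emb (psnd w))
       (bc (bsup (img (fun v => bm (emb (psnd v)) (app f (pair (pfst w) (pfst v))))
                      (psnd z))))) (pfst z))))
     (bc (bsup (img (fun v => bm (emb (psnd v))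
       (bc (bsup (img (fun w => bm (emb (psnd w)) (app f (pair (pfst w) (pfst v))))
                      (pfst z))))) (psnd z)))).

Lemma beq_wf : well_founded (fun y z => mem y (beq_pr z)).
Proof. by apply: wf_pfst => y z /mem_prod[a [b [ha hb ->]]]; rewrite pfst_pair. Qed.

Definition beq (sigma tau : V) : V := wfrec beq_step beq_wf (pair sigma tau).

Definition bmemb (rho tau : V) : V :=
  bsup (img (fun v => bm (emb (psnd v)) (beq rho (pfst v))) tau).

(** Membership with the equations turned round. Thus both halves of [beq] call the recursion with an
    element of the first name in first place, and induction on the first name suffices. *)
Definition bmemb' (rho sigma : V) : V :=
  bsup (img (fun w => bm (emb (psnd w)) (beq (pfst w) rho)) sigma).

Let nmdom_d := dfun1_nmdom M_ZF M_tr.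
#[local] Hint Resolve nmdom_d : dfn.

Lemma dfun2_beq : dfun2 M beq.
Proof.
have d1 : dfun1 M beq_pr by rewrite /beq_pr; dfn.
have d2 : dfun2 M beq_step by rewrite /beq_step; dfn.
have d3 := dfun1_rec beq_wf M_ZF M_tr d1 d2 (wfrecE beq_step beq_wf).
by rewrite /beq; dfn.
Qed.
#[local] Hint Resolve dfun2_beq : dfn.

Lemma dfun2_bmemb : dfun2 M bmemb.
Proof. by rewrite /bmemb; dfn. Qed.

Lemma dfun2_bmemb' : dfun2 M bmemb'.
Proof. by rewrite /bmemb'; dfn. Qed.
#[local] Hint Resolve dfun2_bmemb dfun2_bmemb' : dfn.

Lemma beqE sigma tau : beq sigma tau =
  bm (bc (bsup (img (fun w => bm (emb (psnd w)) (bc (bmemb (pfst w) tau))) sigma)))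
     (bc (bsup (img (fun v => bm (emb (psnd v)) (bc (bmemb' (pfst v) sigma))) tau))).
Proof.
rewrite /beq wfrecE /beq_step pfst_pair psnd_pair.
have E w v : mem w sigma -> mem v tau ->
    app (graph (wfrec beq_step beq_wf) (beq_pr (pair sigma tau)))
        (pair (pfst w) (pfst v)) = beq (pfst w) (pfst v).
  move=> ws vt; apply: app_graph; apply/mem_prod; exists (pfst w), (pfst v).
  by rewrite pfst_pair psnd_pair; split=> //; apply/mem_nmdom; [exists w|exists v].
congr (bm (bc (bsup _)) (bc (bsup _))).
- apply: img_ext => w ws; congr (bm _ (bc (bsup _))).
  by apply: img_ext => v vt; rewrite E.
- apply: img_ext => v vt; congr (bm _ (bc (bsup _))).
  by apply: img_ext => w ws; rewrite E.
Qed.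

Let N := names M P.
Let name_M x : N x -> M x. Proof. by case. Qed.

Lemma name_elt w sigma : N sigma -> mem w sigma ->
  [/\ w = pair (pfst w) (psnd w), N (pfst w), dom P (psnd w) & mem (pfst w) (nmdom sigma)].
Proof.
move=> Ns ws; have E := names_elt Ns ws.
have [||N1 P1] := @names_sub M M_tr P (pfst w) (psnd w) sigma; rewrite -?E //.
by split=> //; apply/mem_nmdom; exists w.
Qed.

(** Membership values and both halves of [beq] are built from suprema of this form. The set of
    disjuncts is in [M] because [F] is definable, so [star_sup] applies. *)
Lemma star_sup_name (F : V -> V) sigma : N sigma -> dfun1 M F ->
  (forall w, mem w sigma -> bdom B (F (pfst w))) ->
  let s := bsup (img (fun w => bm (emb (psnd w)) (F (pfst w))) sigma) in
  bdom B s /\ forall G, generic M P G -> (star G s <->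
    exists tau p, [/\ G p, mem (pair tau p) sigma & star G (F tau)]).
Proof.
move=> Ns Fd FD s.
have Ms : M (img (fun w => bm (emb (psnd w)) (F (pfst w))) sigma).
  have d : dfun1 M (img (fun w => bm (emb (psnd w)) (F (pfst w)))) by dfn.
  exact: (dfun1_M d (name_M Ns)).
have D1 w : mem w sigma -> bdom B (emb (psnd w)).
  by move=> /(name_elt Ns)[_ _ Pw _]; rewrite emb_eq //; exact: pi_dom.
have AB : elts (img (fun w => bm (emb (psnd w)) (F (pfst w))) sigma) `<=` bdom B.
  move=> _ /mem_img[w ws <-]; rewrite bm_eq; first apply: bmeet_dom; auto.
split=> [|G Gg]; first by case: (bsup_sup Ms AB).
rewrite star_sup //; have [Gf _] := Gg; split=> [[_ /mem_img[w ws <-]]|].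
  move/(star_meet Gf (D1 w ws) (FD w ws)).
  have [E _ Pw _] := name_elt Ns ws; move=> [/(star_emb Gf Pw) Gw sF].
  by exists (pfst w), (psnd w); rewrite -E.
move=> [tau [p [Gp ts sF]]]; exists (bm (emb p) (F tau)).
  by apply/mem_img; exists (pair tau p) => //; rewrite pfst_pair psnd_pair.
have := D1 _ ts; have := FD _ ts; rewrite pfst_pair psnd_pair => DF Dp.
by apply/star_meet => //; split=> //; apply/star_emb => //; exact: filter_sub Gf _ Gp.
Qed.

Lemma beq_spec sigma tau : N sigma -> N tau -> bdom B (beq sigma tau) /\
  forall G, generic M P G -> (star G (beq sigma tau) <-> val G sigma = val G tau).
Proof.
elim/(well_founded_ind nmdom_wf): sigma tau => sigma IH tau Ns Nt.
have Ms := name_M Ns; have Mt := name_M Nt.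
have memb w : mem w sigma -> bdom B (bmemb (pfst w) tau) /\ forall G, generic M P G ->
    (star G (bmemb (pfst w) tau) <-> mem (val G (pfst w)) (val G tau)).
  move=> /(name_elt Ns)[_ Nw _ wd]; have Mw := name_M Nw.
  have d : dfun1 M (beq (pfst w)) by dfn.
  have [|D h] := star_sup_name Nt d; first by move=> v /(name_elt Nt)[_ Nv _ _]; apply: (IH _ wd _ Nw Nv).1.
  split=> // G Gg; rewrite h // mem_val.
  split=> -[k [p [Gp pt sk]]]; exists k, p; split=> //;
    have [Nk _] := names_sub M_tr Nt pt; exact/(IH _ wd _ Nw Nk).2.
have memb' v : mem v tau -> bdom B (bmemb' (pfst v) sigma) /\ forall G, generic M P G ->
    (star G (bmemb' (pfst v) sigma) <-> mem (val G (pfst v)) (val G sigma)).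
  move=> /(name_elt Nt)[_ Nv _ vd]; have Mv := name_M Nv.
  have d : dfun1 M (beq^~ (pfst v)) by dfn.
  have [|D h] := star_sup_name Ns d; first by move=> w /(name_elt Ns)[_ Nw _ wd]; apply: (IH _ wd _ Nw Nv).1.
  split=> // G Gg; rewrite h // mem_val.
  split=> -[k [p [Gp pt sk]]]; exists k, p; split=> //;
    have [Nk _ ] := names_sub M_tr Ns pt;
    have kd : mem k (nmdom sigma) by apply/mem_nmdom; exists (pair k p); rewrite ?pfst_pair.
    by apply/esym/(IH _ kd _ Nk Nv).2.
  exact/(IH _ kd _ Nk Nv).2/esym.
(* One inclusion between the values, stated for an arbitrary membership term so as to serve both
   [bmemb] and [bmemb']. *)
have sub (x y : V) (b : V -> V) : N x -> dfun1 M b ->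
    (forall w, mem w x -> bdom B (b (pfst w)) /\ forall G, generic M P G ->
      (star G (b (pfst w)) <-> mem (val G (pfst w)) (val G y))) ->
    let s := bc (bsup (img (fun w => bm (emb (psnd w)) (bc (b (pfst w)))) x)) in
    bdom B s /\ forall G, generic M P G ->
      (star G s <-> forall z, mem z (val G x) -> mem z (val G y)).
  move=> Nx bd hb s; have d : dfun1 M (fun z => bc (b z)) by dfn.
  have Dbc w : mem w x -> bdom B (bc (b (pfst w))).
    by move=> /hb[D _]; rewrite bc_eq //; exact: bcompl_dom.
  have [D h] := star_sup_name Nx d Dbc.
  split=> [|G Gg]; first by rewrite /s bc_eq //; exact: bcompl_dom.
  rewrite star_compl // h //; split=> [n _ /mem_val[k [p [Gp px ->]]]|xy [k [p [Gp px]]]].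
    have := hb _ px; rewrite pfst_pair => -[Dk hk].
    apply/hk => //; apply: contrapT => nk; apply: n; exists k, p; split=> //.
    exact/star_compl.
  have := hb _ px; rewrite pfst_pair => -[Dk hk].
  by move/(star_compl Gg Dk); apply; apply/hk => //; apply: xy; apply/mem_val; exists k, p.
rewrite beqE.
have d1 : dfun1 M (bmemb^~ tau) by dfn.
have d2 : dfun1 M (bmemb'^~ sigma) by dfn.
have [D1 h1] := sub _ _ _ Ns d1 memb; have [D2 h2] := sub _ _ _ Nt d2 memb'.
split=> [|G Gg]; first by rewrite bm_eq //; exact: bmeet_dom.
have S := star_meet Gg.1 D1 D2; split=> [/S[/(h1 G Gg) st /(h2 G Gg) ts]|E].
  by apply: V_extensionality => z; split; auto.
by apply/S; split; [apply/(h1 G Gg)|apply/(h2 G Gg)] => z; rewrite E.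
Qed.

Lemma bmemb_spec sigma tau : N sigma -> N tau -> bdom B (bmemb sigma tau) /\
  forall G, generic M P G -> (star G (bmemb sigma tau) <-> mem (val G sigma) (val G tau)).
Proof.
move=> Ns Nt; have Ms := name_M Ns.
have d : dfun1 M (beq sigma) by dfn.
have [|D h] := star_sup_name Nt d.
  by move=> v /(name_elt Nt)[_ Nv _ _]; apply: (beq_spec Ns Nv).1.
split=> // G Gg; rewrite h // mem_val.
by split=> -[k [p [Gp pt sk]]]; exists k, p; split=> //;
  have [Nk _] := names_sub M_tr Nt pt; exact/(beq_spec Ns Nk).2.
Qed.

Let names_d : drel1 M N := drel1_names M_ZF M_tr (drel1_dom Pd).
#[local] Hint Resolve names_d : dfn.

(* The forcing relation, with environments of names instead of tuples. *)
Fixpoint forc (phi : formula) (p : V) (e : nat -> V) : Prop :=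
  match phi with
  | fMem i j => below p (bmemb (e i) (e j))
  | fEq i j => below p (beq (e i) (e j))
  | fNot psi => dom P p /\ forall q, M q -> le P q p -> ~ forc psi q e
  | fAnd psi chi => forc psi p e /\ forc chi p e
  | fEx psi => dom P p /\ forall q, M q -> le P q p ->
      exists2 r, M r & le P r q /\
        exists2 sigma, M sigma & N sigma /\ forc psi r (scons sigma e)
  end.

(** Definability precedes truth: a generic filter is only required to meet definable dense sets. *)
Lemma dfn_forc phi : dfn M (fun e => forc phi (e 0) (fun i => e i.+1)).
Proof.
elim: phi => /= [i j|i j|psi IH|psi IH chi IH'|psi IH]; try by dfn.
- have := @dfn_ren M _ (fun i => if i is j.+1 then j.+2 else 0) IH; dfn.
  move=> h; dfn.
- have h : dfn M (fun e => forc psi (e 1) (scons (e 0) (fun i => e i.+4))).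
    have := @dfn_ren M _ (fun i => match i with 0 => 1 | 1 => 0 | j.+2 => j.+4 end) IH.
    apply: dfn_iff => e _; suff -> : (fun i => e match i with 0 => 0 | j.+1 => j.+4 end) =
      scons (e 0) (fun i => e i.+4) by [].
    by apply/funext; case.
  by dfn.
Qed.

Lemma drel1_forc phi e : inM M e -> drel1 M (fun p => forc phi p e).
Proof.
move=> eM; apply: (@dfn_subst M _ (fun i => if i is j.+1 then fun=> e j
                         else fun e => e 0) (dfn_forc phi)) => -[|i].
  exact: dfnf_var.
exact: dfnf_const.
Qed.

Lemma forc_mono phi p q e : le P q p -> forc phi p e -> forc phi q e.
Proof.
move=> qp; have [Pq _ _] := qp.
elim: phi e => /= [i j|i j|psi IH|psi IH chi IH'|psi IH] e.
- exact: below_mono.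
- exact: below_mono.
- by move=> [_ h]; split=> // r Mr rq; apply: h => //; exact: le_trans qp.
- by move=> [/IH ? /IH' ?].
- by move=> [_ h]; split=> // r Mr rq; apply: h => //; exact: le_trans qp.
Qed.

Definition inN (e : nat -> V) : Prop := forall i, N (e i).

Lemma forc_dense phi p e : inN e -> dom P p ->
  (forall q, le P q p -> exists2 r, le P r q & forc phi r e) -> forc phi p e.
Proof.
elim: phi e p => /= [i j|i j|psi IH|psi IH chi IH'|psi IH] e p eN Pp h.
- by apply: below_dense => //; case: (bmemb_spec (eN i) (eN j)).
- by apply: below_dense => //; case: (beq_spec (eN i) (eN j)).
- split=> // q Mq qp fq; have [r rq [_ nr]] := h q qp; have [Pr _ _] := rq.
  by apply: (nr r) => //; [exact: dom_M Pr|exact: le_refl|exact: forc_mono fq].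
- split; [apply: IH => // q /h[r rq []]|apply: IH' => // q /h[r rq []]];
    by exists r.
- split=> // q Mq qp; have [r rq [_ hr]] := h q qp; have [Pr _ _] := rq.
  have [s Ms [sr hs]] := hr r (dom_M Pd Pr) (le_refl Pr).
  by exists s => //; split=> //; exact: le_trans rq.
Qed.

Lemma inN_scons x e : N x -> inN e -> inN (scons x e).
Proof. by move=> Nx h [|i] //=. Qed.

Lemma forc_truth phi e G : inN e -> generic M P G ->
  (sat (generic_extension M P G) phi (fun i => val G (e i)) <->
   exists2 p, G p & forc phi p e).
Proof.
move=> + Gg; have [Gf _] := Gg; have GP := filter_sub Gf.
elim: phi e => /= [i j|i j|psi IH|psi IH chi IH'|psi IH] e eN.
- have [D h] := bmemb_spec (eN i) (eN j); rewrite -h //.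
  by split=> -[p Gp pb]; exists p => //; apply/belowP => //; exact: GP.
- have [D h] := beq_spec (eN i) (eN j); rewrite -h //.
  by split=> -[p Gp pb]; exists p => //; apply/belowP => //; exact: GP.
- rewrite IH //; split=> [n|[p Gp [_ hp]] [q Gq fq]].
    have eM : inM M e by move=> i; case: (eN i).
    have [r Gr [fr|nr]] := generic_decides M_ZF M_tr Pd (drel1_forc psi eM) Gg.
      by case: n; exists r.
    by exists r => //; split; [exact: GP|move=> q _; exact: nr].
  have [r [Gr rp rq]] := filter_le Gf Gp Gq.
  by apply: (hp r) => //; [apply: (dom_M Pd); exact: GP|exact: forc_mono fq].
- rewrite IH // IH' //; split=> [[[p Gp fp] [q Gq fq]]|[p Gp [fp fp']]].
    have [r [Gr rp rq]] := filter_le Gf Gp Gq; exists r => //.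
    by split; [exact: forc_mono fp|exact: forc_mono fq].
  by split; exists p.
have E x : scons (val G x) (fun i => val G (e i)) = (fun i => val G (scons x e i)).
  by apply/funext; case.
split=> [[_ [x Nx <-]]|[p Gp [_ hp]]].
  rewrite E IH; last exact: inN_scons.
  move=> [p Gp fp]; exists p => //; split; first exact: GP.
  move=> q Mq qp; exists q => //; have [Pq _ _] := qp.
  split; first exact: le_refl.
  by exists x; [case: Nx|split=> //; exact: forc_mono fp].
have eM : inM M e by move=> i; case: (eN i).
have Qd : drel1 M (fun r => exists2 x, M x & N x /\ forc psi r (scons x e)).
  have h : dfn M (fun e' => forc psi (e' 1) (scons (e' 0) e)).
    have := @dfn_subst M _ (fun i => match i with 0 => fun e => e 1 | 1 => fun e => e 0
       | j.+2 => fun=> e j end) (dfn_forc psi).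
    move=> h; apply: (@dfn_iff _ _ _ _ (h _)) => [e' _|[|[|i]]].
    - suff -> : (fun i => (match i with 0 => fun e => e 0 | j.+1 => fun=> e j end) e') =
        scons (e' 0) e by [].
      by apply/funext; case.
    - exact: dfnf_var.
    - exact: dfnf_var.
    - exact: dfnf_const.
  by dfn.
have [q qp|r Gr [x Mx [Nx fx]]] := generic_below M_ZF M_tr Pd Qd Gg Gp.
  have [Pq _ _] := qp.
  by have [r Mr [rq hr]] := hp q (dom_M Pd Pq) qp; exists r.
exists (val G x); first by exists x.
by rewrite E IH; [exists r|exact: inN_scons].
Qed.

(** If [forc] fails at [p], then by [forc_dense] it fails at all extensions of some [q] below [p]. A
    generic filter through [q], which exists as [M] is countable, then contradicts [forc_truth]. *)
Lemma forces_forc phi p sigma : dom P p -> (forall x, x \in sigma -> N x) ->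
  (forces M P p phi sigma <-> forc phi p (env sigma (fun=> emptyset))).
Proof.
move=> Pp sN; set e := env _ _.
have N0 : N emptyset by exact: (names_emptyset M_ZF M_tr).
have eN : inN e by exact: env_M.
(* Beyond the tuple both environments agree, since the name [emptyset] has itself as value. *)
have E G : env [seq val G x | x <- sigma] (fun=> emptyset) = (fun i => val G (e i)).
  apply/funext => i; rewrite /e !(env_nth _ _ emptyset) size_map.
  case: ltnP => ik; first by rewrite (nth_map emptyset).
  by apply: V_extensionality => z; rewrite mem_val; split=> [/mem_emptyset//|[? [? [_ /mem_emptyset]]]].
split=> [h|fp G Gg Gp]; last by rewrite /sat_ext E; apply/forc_truth => //; exists p.
apply: forc_dense => // q qp; apply: contrapT => n.
have [Pq _ _] := qp; have [G Gg Gq] := generic_ex M_countable Pq.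
have := h G Gg (filter_up_le Gg.1 Gq qp); rewrite /sat_ext E => /(forc_truth _ eN Gg)[r Gr fr].
have [s [Gs sr sq]] := filter_le Gg.1 Gr Gq.
by apply: n; exists s => //; exact: forc_mono fr.
Qed.

Lemma completion_forcing_theorem n phi : forcing_theorem M P n phi.
Proof.
have N0 : N emptyset by exact: (names_emptyset M_ZF M_tr).
split; last first.
  move=> sigma G [_ sN] Gg h.
  have eN : inN (env sigma (fun=> emptyset)) by exact: env_M.
  have E : env [seq val G x | x <- sigma] (fun=> emptyset) =
      (fun i => val G (env sigma (fun=> emptyset) i)).
    apply/funext => i; rewrite !(env_nth _ _ emptyset) size_map.
    case: ltnP => ik; first by rewrite (nth_map emptyset).
    by apply: V_extensionality => z; rewrite mem_val; split=> [/mem_emptyset//|[? [? [_ /mem_emptyset]]]].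
  move: h; rewrite /sat_ext E => /(forc_truth _ eN Gg)[p Gp fp].
  by exists p => //; apply/forces_forc => //; exact: filter_sub Gg.1 _ Gp.
have Qd : dfn M (fun e => (dom P (e 0) /\ forall i, i < n -> N (e i.+1)) /\
                          forc phi (e 0) (fun i => e i.+1)).
  apply: dfn_and; last exact: dfn_forc.
  apply: dfn_and; first by dfn.
  (* The quantifier over [i < n] is external to [M]; it unfolds into a finite conjunction. *)
  elim: n => [|n IH].
    by apply: (@dfn_iff _ (fun e => e 0 = e 0)); [move=> e _; split|dfn].
  apply: (@dfn_iff _ (fun e => (forall i, i < n -> N (e i.+1)) /\ N (e n.+1))).
    move=> e _; split=> [[h h'] i|h]; last by split=> [i ik|]; apply: h => //; exact: ltnW.
    by rewrite ltnS leq_eqVlt => /orP[/eqP ->|/h].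
  by dfn.
apply: (definable_dfn (e0 := fun=> emptyset) _ Qd); first by move=> i; case: N0.
case=> [|p sigma] /=; first by split=> // -[].
split.
  move=> [Pp [sn sN] /forces_forc h]; split; [by rewrite sn| |].
  - by move=> x; rewrite inE => /orP[/eqP ->|/sN[]//]; exact: dom_M Pp.
  - split; last by apply: h.
    split=> // i; rewrite -sn => ik.
    by rewrite (env_nth _ _ emptyset) ik; apply: sN; rewrite mem_nth.
move=> [[sn] sM [[Pp sN] h]].
have sN' x : x \in sigma -> N x.
  move=> /(nthP emptyset)[i ik <-]; have := sN i; rewrite -sn => /(_ ik).
  by rewrite (env_nth _ _ emptyset) ik.
by split=> //; exact/forces_forc.
Qed.

End FromCompletion.

(** * Quotients by definable equivalence relations *)

Section Scott.
Variables (M : set V) (M_ZF : ZFminus M) (M_tr : is_transitive M).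
Hypothesis M_pow : powerset_axiom M.

Definition pow (s : V) : V := the (fun y => M y /\
  forall z, M z -> (mem z y <-> forall w, mem w z -> mem w s)).

Lemma mem_pow z s : M s -> (mem z (pow s) <-> M z /\ forall w, mem w z -> mem w s).
Proof.
move=> Ms; have [y My hy] := M_pow Ms.
have [Mp hp] : M (pow s) /\ forall z, M z -> (mem z (pow s) <-> forall w, mem w z -> mem w s).
  apply: (@the_spec (fun y => M y /\ _) y); split=> // {}z Mz; rewrite hy //.
  by split=> h w wz; apply: h => //; exact: memM wz.
split=> [zp|[Mz zs]]; last exact/(hp _ Mz).
by have Mz := memM M_tr Mp zp; split=> //; exact/(hp _ Mz).
Qed.

Lemma dfun1_pow : dfun1 M pow.
Proof.
apply: (dfnf_the M_ZF M_tr (Q := fun y e => M y /\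
  forall z, M z -> (mem z y <-> forall w, mem w z -> mem w (e 0)))).
- by move=> e x _ [].
- move=> e x y _ [Mx hx] [My hy]; apply: V_extensionality => z; split=> zx.
    by have Mz := memM M_tr Mx zx; apply/hy => //; apply/hx.
  by have Mz := memM M_tr My zx; apply/hx => //; apply/hy.
apply: (@dfn_iff _ (fun e => forall z, M z ->
  (mem z (e 0) <-> forall w, mem w z -> mem w (e 1)))); last by dfn.
by move=> e eM; split=> [?|[]].
Qed.
#[local] Hint Resolve dfun1_pow : dfn.

(* [stage x] is the level of the cumulative hierarchy of [M] indexed by the
   rank of [x]. *)
Definition stage : V -> V :=
  wfrec (fun x f => cup (img (fun y => pow (app f y)) x)) mem_wf.

Lemma dfun1_stage : dfun1 M stage.
Proof.
have d1 : dfun1 M id by exact: dfnf_var.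
have d2 : dfun2 M (fun x f => cup (img (fun y => pow (app f y)) x)) by dfn.
exact: (dfun1_rec mem_wf M_ZF M_tr d1 d2 (wfrecE _ mem_wf)).
Qed.
#[local] Hint Resolve dfun1_stage : dfn.

Lemma mem_stage z x : M x ->
  (mem z (stage x) <-> M z /\ exists2 y, mem y x & forall w, mem w z -> mem w (stage y)).
Proof.
move=> Mx; rewrite /stage wfrecE mem_cup.
have st y : mem y x -> M (stage y).
  by move=> yx; apply: (dfun1_M dfun1_stage); exact: memM yx.
split=> [[_ /mem_img[y yx <-]]|[Mz [y yx h]]].
  by rewrite (app_graph stage) // => /(mem_pow _ (st y yx))[Mz h]; split=> //; exists y.
exists (pow (stage y)); last by apply/(mem_pow _ (st y yx)).
by apply/mem_img; exists y => //; rewrite (app_graph stage).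
Qed.

Lemma sub_stage x : M x -> forall w, mem w x -> mem w (stage x).
Proof.
elim/(well_founded_ind mem_wf): x => x IH Mx w wx.
have Mw := memM M_tr Mx wx; apply/mem_stage => //; split=> //.
by exists w => //; exact: IH.
Qed.

Lemma stage_mono x y : M x -> M y -> (forall w, mem w x -> mem w (stage y)) ->
  forall w, mem w (stage x) -> mem w (stage y).
Proof.
elim/(well_founded_ind mem_wf): x y => x IH y Mx My xy w.
move=> /(mem_stage _ Mx)[Mw [s sx ws]]; have Ms := memM M_tr Mx sx.
have /(mem_stage _ My)[_ [r ry sr]] := xy s sx; have Mr := memM M_tr My ry.
apply/mem_stage => //; split=> //; exists r => // t /ws.
exact: IH.
Qed.

(** Comparison of ranks: [x] in [stage y] means that [x] has smaller rank than [y], and [y] included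
    in [stage x] that its rank is at most that of [x]. *)
Lemma stage_total x y : M x -> M y ->
  mem x (stage y) \/ forall w, mem w y -> mem w (stage x).
Proof.
elim/(well_founded_ind mem_wf): y x => y IH x Mx My.
have [[v vy xv]|n] := pselect (exists2 v, mem v y & forall w, mem w x -> mem w (stage v)).
  by left; apply/mem_stage => //; split=> //; exists v.
right=> v vy; have Mv := memM M_tr My vy.
apply: contrapT => nv; apply: n; exists v => // w wx; have Mw := memM M_tr Mx wx.
case: (IH v vy w Mw Mv) => // vw; case: nv; apply/mem_stage => //.
by split=> //; exists w.
Qed.

(** Otherwise induction on [y] shows that no member of [X] is included in [stage y], yet every [x]
    is included in [stage x]. *)
Lemma stage_min (X : set V) : X `<=` M -> X !=set0 ->
  exists2 y, X y & forall z, X z -> ~ mem z (stage y).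
Proof.
move=> XM [x Xx]; apply: contrapT => n.
suff h y : M y -> forall z, X z -> (forall w, mem w z -> mem w (stage y)) -> False.
  exact: h (XM _ Xx) x Xx (sub_stage (XM _ Xx)).
elim/(well_founded_ind mem_wf): y => y IH My z Xz zy; have Mz := XM _ Xz.
apply: n; exists z => // t Xt /mem_stage[]// _ [w wz tw].
have Mw := memM M_tr Mz wz.
have /(mem_stage _ My)[_ [v vy wv]] := zy w wz; have Mv := memM M_tr My vy.
by apply: (IH v vy Mv t Xt) => s /tw; exact: stage_mono.
Qed.

Lemma scott_quotient (E : V -> V -> Prop) : drel2 M E ->
  (forall x, M x -> E x x) ->
  (forall x y, M x -> M y -> E x y -> E y x) ->
  (forall x y z, M x -> M y -> M z -> E x y -> E y z -> E x z) ->
  exists rep, dfun1 M rep /\ forall x y, M x -> M y -> (rep x = rep y <-> E x y).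
Proof.
move=> Ed Er Es Et.
pose least y x := E y x /\ forall z, M z -> E z x -> ~ mem z (stage y).
pose C c x := M c /\ forall y, M y -> (mem y c <-> least y x).
have C_uniq c c' x : C c x -> C c' x -> c = c'.
  move=> [Mc hc] [Mc' hc']; apply: V_extensionality => z; split=> zc.
    by have Mz := memM M_tr Mc zc; apply/hc' => //; apply/hc.
  by have Mz := memM M_tr Mc' zc; apply/hc => //; apply/hc'.
have least_d : drel2 M least by rewrite /least; dfn.
have least_ex x : M x -> exists2 y, M y & least y x.
  move=> Mx; have [||y [My Eyx] hy] := @stage_min [set y | M y /\ E y x].
  - by move=> y [].
  - by exists x; split=> //; exact: Er.
  by exists y => //; split=> // z Mz Ezx; apply: hy.
have C_ex x : M x -> exists c, C c x.
  move=> Mx; have [y0 My0 [E0 h0]] := least_ex x Mx.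
  have d : dfn M (fun e => least (e 0) x) by dfn.
  (* By [stage_total], an equivalent element not included in [stage y0] has larger rank than [y0],
     so this power set contains all equivalent elements of least rank. *)
  exists (sep (pow (stage y0)) (least^~ x)); split.
    apply: (@M_sep M M_ZF M_tr (fun y _ => least y x) _ (fun=> x) d) => //.
    exact/(dfun1_M dfun1_pow)/(dfun1_M dfun1_stage).
  move=> y My; rewrite mem_sep; split=> [[]//|ly]; split=> //.
  apply/mem_pow; first exact: (dfun1_M dfun1_stage).
  split=> //; case: (stage_total My0 My) => // y0y.
  by case: ly => _ /(_ y0 My0 E0).
pose rep x := the (C^~ x).
have repP x : M x -> C (rep x) x.
  by move=> /C_ex[c]; exact: (@the_spec (C^~ x)).
exists rep; split.
  apply: (dfnf_the M_ZF M_tr (Q := fun c e => C c (e 0))).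
  - by move=> e x _ [].
  - by move=> e x y _; exact: C_uniq.
  - apply: (@dfn_iff _ (fun e => forall y, M y -> (mem y (e 0) <-> least y (e 1)))).
      by move=> e eM; split=> [?|[]].
    by dfn.
move=> x y Mx My; split=> [rxy|Exy].
  have [_ hx] := repP x Mx; have [_ hy] := repP y My.
  have [z Mz lz] := least_ex x Mx; have /hx := lz => /(_ Mz).
  rewrite rxy => /hy - /(_ Mz)[Ezy _]; case: lz => Ezx _.
  by apply: Et Ezy => //; exact: Es.
apply: C_uniq (repP x Mx) _; have [Mc hc] := repP y My; split=> // z Mz; rewrite hc //.
have EE w : M w -> (E w x <-> E w y).
  by move=> Mw; split=> h; [exact: Et Exy|apply: Et h _ => //; exact: Es].
by split=> -[/EE h1 h2]; (split; first exact: h1) => t Mt /EE h; apply: h2 => //; exact: h.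
Qed.

End Scott.

Lemma wo_quotient (M : set V) (R E : V -> V -> Prop) : ZFminus M -> is_transitive M ->
  is_well_order M R -> definable_rel M M R -> drel2 M E ->
  (forall x, M x -> E x x) ->
  (forall x y, M x -> M y -> E x y -> E y x) ->
  (forall x y z, M x -> M y -> M z -> E x y -> E y z -> E x z) ->
  exists rep, dfun1 M rep /\ forall x y, M x -> M y -> (rep x = rep y <-> E x y).
Proof.
move=> M_ZF M_tr Rwo /drel2_rel; set R' := fun x y => [/\ _, _ & _].
move=> Rd Ed Er Es Et.
pose C y x := [/\ M y, E y x & forall z, M z -> E z x -> R' y z].
have C_uniq y y' x : C y x -> C y' x -> y = y'.
  move=> [My Ey hy] [My' Ey' hy']; apply: (wo_antisym Rwo) => //.
    by case: (hy y' My' Ey').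
  by case: (hy' y My Ey).
pose rep x := the (C^~ x).
have repP x : M x -> C (rep x) x.
  move=> Mx; have [||y [My Eyx] hy] := wo_least Rwo (X := [set y | M y /\ E y x]).
  - by move=> y [].
  - by exists x; split=> //; exact: Er.
  apply: (@the_spec (C^~ x) y); split=> // z Mz Ezx; split=> //.
  exact: hy.
exists rep; split.
  apply: (dfnf_the M_ZF M_tr (Q := fun c e => C c (e 0))).
  - by move=> e x _ [].
  - by move=> e x y _; exact: C_uniq.
  - apply: (@dfn_iff _ (fun e => E (e 0) (e 1) /\ forall z, M z -> E z (e 1) -> R' (e 0) z)).
      by move=> e eM; split=> [[]|[]].
    by dfn.
move=> x y Mx My; split=> [rxy|Exy].
  have [Mr Erx _] := repP x Mx; have [_ Ery _] := repP y My; rewrite -rxy in Ery.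
  by apply: Et Ery => //; exact: Es.
apply: C_uniq (repP x Mx) _; have [Mc Ec hc] := repP y My; split=> //.
  by apply: Et Ec _ => //; exact: Es.
by move=> z Mz Ezx; apply: hc => //; exact: Et Exy.
Qed.

(** * From the forcing theorem to a Boolean completion *)

Lemma img_img F H x : img F (img H x) = img (fun w => F (H w)) x.
Proof.
apply: V_extensionality => z; rewrite !mem_img; split=> [[_ /mem_img[w wx <-] <-]|[w wx <-]].
  by exists w.
by exists (H w) => //; apply/mem_img; exists w.
Qed.

Lemma img_upair F x y : img F (upair x y) = upair (F x) (F y).
Proof.
apply: V_extensionality => z; rewrite mem_img mem_upair.
split=> [[w /mem_upair[->|->] <-]|[]->]; auto.
- by exists x => //; apply/mem_upair; left.
- by exists y => //; apply/mem_upair; right.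
Qed.

Lemma img_cup2 F x y : img F (cup2 x y) = cup2 (img F x) (img F y).
Proof.
apply: V_extensionality => z; rewrite mem_cup2 !mem_img; split.
  by move=> [w /mem_cup2[wx|wy] <-]; [left|right]; exists w.
by move=> [] [w wx <-]; exists w => //; apply/mem_cup2; auto.
Qed.

Lemma upair_sing x y z : upair x y = sing z -> x = y.
Proof.
move=> E; have h w : mem w (upair x y) -> w = z by rewrite E => /mem_sing.
have -> : x = z by apply: h; apply/mem_upair; left.
by apply/esym/h/mem_upair; right.
Qed.

(* Disjunctions and conjunctions of equations [f x = g x] as single equations:
   with [A = {{f x, g x} | x}], one of them holds iff [A = A + {{f x}}] for
   some [x], and all of them hold iff every member of [A] is some [{f x}]. *)
Lemma eq_disjunction (f g : V -> V) J :
  let A := img (fun x => upair (f x) (g x)) J in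
  let C := img (fun x => cup2 A (sing (sing (f x)))) J in
  cup2 C (sing A) = C <-> exists2 x, mem x J & f x = g x.
Proof.
move=> A C; split=> [E|[x xJ fg]].
  have : mem A C by rewrite -E; apply/mem_cup2; right; apply/mem_sing.
  move=> /mem_img[x xJ E']; have : mem (sing (f x)) A.
    by rewrite -E'; apply/mem_cup2; right; apply/mem_sing.
  by move=> /mem_img[y yJ /upair_sing]; exists y.
apply: V_extensionality => z; rewrite mem_cup2; split=> [[//|/mem_sing ->]|]; last by left.
apply/mem_img; exists x => //; apply: V_extensionality => w; rewrite mem_cup2.
split=> [[//|/mem_sing ->]|]; last by left.
by apply/mem_img; exists x => //; rewrite -fg.
Qed.

Lemma eq_conjunction (f g : V -> V) J :
  let A := img (fun x => upair (f x) (g x)) J in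
  let C := img (fun x => sing (f x)) J in
  cup2 A C = C <-> forall x, mem x J -> f x = g x.
Proof.
move=> A C; split=> [E x xJ|fg].
  have : mem (upair (f x) (g x)) C.
    by rewrite -E; apply/mem_cup2; left; apply/mem_img; exists x.
  by move=> /mem_img[y yJ /esym/upair_sing].
apply: V_extensionality => z; rewrite mem_cup2; split=> [[|//]|]; last by right.
by move=> /mem_img[x xJ <-]; apply/mem_img; exists x => //; rewrite -fg.
Qed.

(** * Codes: complementary equations between names *)

Section Codes.
Variables (M : set V) (M_ZF : ZFminus M) (M_tr : is_transitive M) (P : porder).
Hypotheses (M_countable : countable M) (Pd : porder_definable M P).

Let Pdom := drel1_dom Pd.
Let Ple := drel2_le Pd.
Let nmdom_d := dfun1_nmdom M_ZF M_tr.
#[local] Hint Resolve Pdom Ple nmdom_d : dfn.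

(* As [P] need not have a largest element, names are built from the pairs
   [(tau, {})], standing for [(tau, 1)], and [(tau, {q})], standing for
   [(tau, q)]; a condition [p] turns such a set into a [P]-name, whose value
   does not depend on [p] as long as [p] is in the filter. *)
Definition tag (s p : V) : V := sep (cup2 s (sing p)) (fun q =>
  dom P q /\ (s = emptyset /\ q = p \/ s = sing q)).

(** The condition is a fixed parameter, carried through the recursion as second component. *)
Definition toname_pr (z : V) : V := prod (nmdom (pfst z)) (sing (psnd z)).

Definition toname_step (z f : V) : V := cup (img (fun w =>
  img (fun q => pair (app f (pair (pfst w) (psnd z))) q) (tag (psnd w) (psnd z)))
  (pfst z)).

Lemma toname_wf : well_founded (fun y z => mem y (toname_pr z)).
Proof. by apply: wf_pfst => y z /mem_prod[a [b [ha hb ->]]]; rewrite pfst_pair. Qed.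

Definition toname (x p : V) : V := wfrec toname_step toname_wf (pair x p).

Lemma dfun2_toname : dfun2 M toname.
Proof.
have d1 : dfun1 M toname_pr by rewrite /toname_pr; dfn.
have d2 : dfun2 M toname_step by rewrite /toname_step /tag; dfn.
have d3 := dfun1_rec toname_wf M_ZF M_tr d1 d2 (wfrecE toname_step toname_wf).
by rewrite /toname; dfn.
Qed.
#[local] Hint Resolve dfun2_toname : dfn.

Lemma mem_tag q s p : mem q (tag s p) <->
  dom P q /\ (s = emptyset /\ q = p \/ s = sing q).
Proof.
rewrite mem_sep; split=> [[]//|[Pq h]]; split=> //; apply/mem_cup2.
by case: h => [[_ ->]|->]; [right|left]; apply/mem_sing.
Qed.

Lemma mem_toname z x p : mem z (toname x p) <-> exists2 w, mem w x &
  exists2 q, mem q (tag (psnd w) p) & z = pair (toname (pfst w) p) q.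
Proof.
rewrite /toname wfrecE mem_cup pfst_pair psnd_pair.
have E w : mem w x -> app (graph (wfrec toname_step toname_wf) (toname_pr (pair x p)))
    (pair (pfst w) p) = toname (pfst w) p.
  move=> wx; apply: app_graph; apply/mem_prod; exists (pfst w), p.
  by rewrite pfst_pair psnd_pair; split=> //; [apply/mem_nmdom; exists w|apply/mem_sing].
split=> [[_ /mem_img[w wx <-] /mem_img[q qt <-]]|[w wx [q qt ->]]].
  by exists w => //; exists q => //; rewrite E.
exists (img (fun q => pair (toname (pfst w) p) q) (tag (psnd w) p)).
  by apply/mem_img; exists w => //; rewrite E.
by apply/mem_img; exists q.
Qed.

Lemma names_toname x p : M x -> dom P p -> names M P (toname x p).
Proof.
move=> Mx Pp; split; first exact: dfun2_M dfun2_toname Mx (dom_M Pd Pp).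
elim/(well_founded_ind nmdom_wf): x {Mx} => x IH.
constructor=> _ /mem_toname[w wx [q /mem_tag[Pq _] ->]].
exists (toname (pfst w) p), q; split=> //; apply: IH.
by apply/mem_nmdom; exists w.
Qed.

Lemma val_toname_indep G x p p' : is_filter P G -> G p -> G p' ->
  val G (toname x p) = val G (toname x p').
Proof.
move=> Gf; elim/(well_founded_ind nmdom_wf): x p p' => x IH p p' Gp Gp'.
suff S r r' : G r -> G r' -> forall z, mem z (val G (toname x r)) -> mem z (val G (toname x r')).
  by apply: V_extensionality => z; split; exact: S.
move=> {p p' Gp Gp'} Gr Gr' z.
move=> /mem_val[t [q [Gq /mem_toname[w wx [q' /mem_tag[Pq' h] /pair_inj[-> Eq]]] ->]]].
subst q'; apply/mem_val; exists (toname (pfst w) r').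
(* An element standing for the weight 1 was paired with [r] and is now paired with [r']; a tagged
   one keeps its condition. *)
exists (if pselect (psnd w = emptyset) then r' else q); split.
- by case: pselect.
- apply/mem_toname; exists w => //.
  exists (if pselect (psnd w = emptyset) then r' else q) => //.
  apply/mem_tag; case: pselect => [e|n]; first by split; [exact: filter_sub Gf _ Gr'|left].
  by split=> //; right; case: h => [[/n]|].
- by apply: IH => //; apply/mem_nmdom; exists w.
Qed.

(* The name [{(x, 1) | x in a}]. *)
Definition nameset (a : V) : V := img (fun x => pair x emptyset) a.

Lemma dfun1_nameset : dfun1 M nameset.
Proof. by rewrite /nameset; dfn. Qed.
#[local] Hint Resolve dfun1_nameset : dfn.

Lemma val_nameset G a p : is_filter P G -> G p ->
  val G (toname (nameset a) p) = img (fun x => val G (toname x p)) a.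
Proof.
move=> Gf Gp; apply: V_extensionality => z; rewrite mem_val mem_img; split.
  move=> [t [q [Gq /mem_toname[_ /mem_img[x xa <-] [q' _ /pair_inj[-> _]]] ->]]].
  by exists x; rewrite ?pfst_pair.
move=> [x xa <-]; exists (toname x p), p; split=> //; apply/mem_toname.
exists (pair x emptyset); first by apply/mem_img; exists x.
exists p; last by rewrite pfst_pair.
by apply/mem_tag; rewrite psnd_pair; split; [exact: filter_sub Gf _ Gp|left].
Qed.

Lemma val_toname0 G p : val G (toname emptyset p) = emptyset.
Proof.
apply: V_extensionality => z; rewrite mem_val; split=> [|/mem_emptyset//].
by move=> [t [q [_ /mem_toname[w /mem_emptyset]]]].
Qed.

(* A code is a quadruple ((a, b), (c, d)) such that, for each generic filter,
   exactly one of [a = b] (the code is true) and [c = d] (it is false) holds. *)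
Definition holds_eq (G : set V) (x : V) : Prop :=
  exists2 p, G p & val G (toname (pfst x) p) = val G (toname (psnd x) p).

Definition tru (G : set V) (x : V) : Prop := holds_eq G (pfst x).

Definition code (x : V) : Prop :=
  M x /\ forall G, generic M P G -> (holds_eq G (psnd x) <-> ~ tru G x).

Lemma holds_eqE G x p : is_filter P G -> G p -> (holds_eq G x <->
  val G (toname (pfst x) p) = val G (toname (psnd x) p)).
Proof.
move=> Gf Gp; split=> [[q Gq]|]; last by exists p.
by rewrite (val_toname_indep _ Gf Gq Gp) (val_toname_indep (psnd x) Gf Gq Gp).
Qed.

Lemma M_pfst x : M x -> M (pfst x).
Proof. by apply: dfun1_M; exact: dfun1_pfst. Qed.

Lemma M_psnd x : M x -> M (psnd x).
Proof. by apply: dfun1_M; exact: dfun1_psnd. Qed.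

Lemma code_pair x y : M x -> M y ->
  (forall G, generic M P G -> (holds_eq G y <-> ~ holds_eq G x)) -> code (pair x y).
Proof.
move=> Mx My h; split; first exact: M_pair.
by move=> G Gg; rewrite /tru pfst_pair psnd_pair; exact: h.
Qed.

Lemma code_compl x : code x -> exists2 y, code y &
  forall G, generic M P G -> (tru G y <-> ~ tru G x).
Proof.
move=> [Mx h]; exists (pair (psnd x) (pfst x)); last first.
  by move=> G Gg; rewrite /tru pfst_pair h.
apply: code_pair; [exact: M_psnd|exact: M_pfst|move=> G Gg].
by rewrite h // notE.
Qed.

Lemma code_atom q : dom P q -> exists2 y, code y &
  forall G, generic M P G -> (tru G y <-> G q).
Proof.
move=> Pq; have Mq := dom_M Pd Pq; have M0 := M_emptyset M_ZF M_tr.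
pose a := sing (pair emptyset (sing q)); pose b := nameset (sing emptyset).
have Ma : M a.
  by do 2?apply: M_upair => //; do 2?apply: M_upair => //; apply: M_upair.
have Mb : M b by apply: (dfun1_M dfun1_nameset); exact: M_upair.
have va G p : is_filter P G -> G p -> val G (toname a p) =
    if pselect (G q) then sing emptyset else emptyset.
  move=> Gf Gp; apply: V_extensionality => z; rewrite mem_val; case: pselect => Gq; split.
  - move=> [t [r [Gr /mem_toname[w /mem_sing -> [r' _ /pair_inj[-> _]]] ->]]].
    by rewrite pfst_pair val_toname0; apply/mem_sing.
  - move=> /mem_sing ->; exists (toname emptyset p), q; rewrite val_toname0; split=> //.
    apply/mem_toname; exists (pair emptyset (sing q)); first exact/mem_sing.
    by exists q; rewrite ?pfst_pair // psnd_pair; apply/mem_tag; split; auto.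
  - move=> [t [r [Gr /mem_toname[w /mem_sing -> [r' /mem_tag[_ h] /pair_inj[_ Er]]] _]]].
    subst r'; move: h; rewrite psnd_pair => -[[E _]|E].
      by case: (@mem_emptyset q); rewrite -E; apply/mem_sing.
    by case: Gq; have /mem_sing -> : mem q (sing r) by rewrite -E; apply/mem_sing.
  - by move=> /mem_emptyset.
have vb G p : is_filter P G -> G p -> val G (toname b p) = sing emptyset.
  by move=> Gf Gp; rewrite val_nameset // img_upair val_toname0.
have s0 : emptyset <> sing emptyset.
  by move=> E; apply: (@mem_emptyset emptyset); rewrite {2}E; apply/mem_sing.
have t1 G : generic M P G -> (holds_eq G (pair a b) <-> G q).
  move=> [Gf _]; have [p Gp] := filter_nonempty Gf.
  rewrite (holds_eqE _ Gf Gp) pfst_pair psnd_pair va // vb //.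
  by case: pselect => Gq; split.
(* The value of [a] is the singleton of the empty set if [q] is in [G] and empty otherwise, so
   [a = emptyset] is the complementary equation. *)
exists (pair (pair a b) (pair a emptyset)); last first.
  by move=> G Gg; rewrite /tru pfst_pair t1.
apply: code_pair => [||G Gg]; try exact: M_pair.
rewrite t1 //; have [Gf _] := Gg; have [p Gp] := filter_nonempty Gf.
rewrite (holds_eqE _ Gf Gp) pfst_pair psnd_pair va // val_toname0.
by case: pselect => Gq; split=> // /esym.
Qed.

Lemma code_sup J : M J -> (forall x, mem x J -> code x) -> exists2 y, code y &
  forall G, generic M P G -> (tru G y <-> exists2 x, mem x J & tru G x).
Proof.
move=> MJ Jc.
(* [A] and [C] name the sets of [eq_disjunction] for the first equations, [D] and [E] those of
   [eq_conjunction] for the second ones. They are functions of [J] so that definability puts the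
   names in [M]. *)
pose A J := img (fun x => nameset (upair (pfst (pfst x)) (psnd (pfst x)))) J.
pose C J := img (fun x => nameset (cup2 (A J)
  (sing (nameset (sing (pfst (pfst x))))))) J.
pose D J := img (fun x => nameset (upair (pfst (psnd x)) (psnd (psnd x)))) J.
pose E J := img (fun x => nameset (sing (pfst (psnd x)))) J.
pose x1 := pair (nameset (cup2 (C J) (sing (nameset (A J))))) (nameset (C J)).
pose x2 := pair (nameset (cup2 (D J) (E J))) (nameset (E J)).
have t1 G : generic M P G -> (holds_eq G x1 <-> exists2 x, mem x J & tru G x).
  move=> [Gf _]; have [p Gp] := filter_nonempty Gf; pose v x := val G (toname x p).
  have vn a : v (nameset a) = img v a by exact: val_nameset.
  rewrite (holds_eqE _ Gf Gp) pfst_pair psnd_pair -/(v _) -/(v _).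
  have vA : img v (A J) = img (fun x => upair (v (pfst (pfst x))) (v (psnd (pfst x)))) J.
    by rewrite img_img; apply: img_ext => x _; rewrite vn img_upair.
  have vC : img v (C J) = img (fun x => cup2 (img v (A J)) (sing (sing (v (pfst (pfst x)))))) J.
    by rewrite img_img; apply: img_ext => x _; rewrite vn img_cup2 img_upair vn img_upair.
  rewrite !vn img_cup2 img_upair vn vC vA.
  rewrite (eq_disjunction (fun x => v (pfst (pfst x))) (fun x => v (psnd (pfst x))) J).
  by split=> -[x xJ h]; exists x => //; apply/(holds_eqE _ Gf Gp).
have t2 G : generic M P G -> (holds_eq G x2 <-> forall x, mem x J -> holds_eq G (psnd x)).
  move=> [Gf _]; have [p Gp] := filter_nonempty Gf; pose v x := val G (toname x p).
  have vn a : v (nameset a) = img v a by exact: val_nameset.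
  rewrite (holds_eqE _ Gf Gp) pfst_pair psnd_pair -/(v _) -/(v _).
  have vD : img v (D J) = img (fun x => upair (v (pfst (psnd x))) (v (psnd (psnd x)))) J.
    by rewrite img_img; apply: img_ext => x _; rewrite vn img_upair.
  have vE : img v (E J) = img (fun x => sing (v (pfst (psnd x)))) J.
    by rewrite img_img; apply: img_ext => x _; rewrite vn img_upair.
  rewrite !vn img_cup2 vD vE.
  rewrite (eq_conjunction (fun x => v (pfst (psnd x))) (fun x => v (psnd (psnd x))) J).
  by split=> h x /h h'; apply/(holds_eqE _ Gf Gp).
exists (pair x1 x2); last by move=> G Gg; rewrite /tru pfst_pair t1.
apply: code_pair => [||G Gg].
- have d : dfun1 M (fun J => pair (nameset (cup2 (C J) (sing (nameset (A J))))) (nameset (C J))).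
    by rewrite /C /A; dfn.
  exact: dfun1_M d MJ.
- have d : dfun1 M (fun J => pair (nameset (cup2 (D J) (E J))) (nameset (E J))).
    by rewrite /D /E; dfn.
  exact: dfun1_M d MJ.
rewrite t1 // t2 //; split=> [h [x xJ tx]|h x xJ].
  by have [_ /(_ G Gg)[c _]] := Jc x xJ; exact: (c (h x xJ) tx).
by have [_ /(_ G Gg)[_]] := Jc x xJ; apply=> tx; apply: h; exists x.
Qed.

Hypothesis FT : forall n phi, fv_below n phi -> forcing_theorem M P n phi.

Definition frc (p x : V) : Prop :=
  dom P p /\ forall G, generic M P G -> G p -> tru G x.

Lemma name_seq_toname p xs : dom P p -> (forall x, x \in xs -> M x) ->
  name_seq M P (size xs) [seq toname x p | x <- xs].
Proof.
move=> Pp xM; split; first by rewrite size_map.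
by move=> t /mapP[x /xM Mx ->]; exact: names_toname.
Qed.

Lemma frc_forces p x : dom P p -> (frc p x <->
  forces M P p (fEq 0 1) [:: toname (pfst (pfst x)) p; toname (psnd (pfst x)) p]).
Proof.
move=> Pp; split=> [[_ h] G Gg Gp|h].
  by apply/(holds_eqE _ Gg.1 Gp); exact: h.
by split=> // G Gg Gp; apply/(holds_eqE _ Gg.1 Gp); exact: h.
Qed.

Definition code_fml : formula :=
  fAnd (fNot (fAnd (fEq 0 1) (fEq 2 3)))
       (fNot (fAnd (fNot (fEq 0 1)) (fNot (fEq 2 3)))).

(** [code] quantifies over generic filters, which need not lie in [M]. Each contains some [p], so
    this can be traded for forcing by all conditions, where [p] also turns the components into
    names. *)
Lemma code_forces x : M x -> (code x <-> forall p, M p -> dom P p ->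
  forces M P p code_fml [:: toname (pfst (pfst x)) p; toname (psnd (pfst x)) p;
                            toname (pfst (psnd x)) p; toname (psnd (psnd x)) p]).
Proof.
move=> Mx.
have E G p : generic M P G -> G p -> (sat_ext M P G code_fml
    [:: toname (pfst (pfst x)) p; toname (psnd (pfst x)) p;
        toname (pfst (psnd x)) p; toname (psnd (psnd x)) p] <->
    (holds_eq G (psnd x) <-> ~ tru G x)).
  move=> Gg Gp; rewrite /tru !(holds_eqE _ Gg.1 Gp) /sat_ext /=.
  set a := _ = _; set b := _ = _; split=> [[h h']|[h h']].
    by split=> [hb ha|na]; [apply: h|apply: contrapT => nb; apply: h'].
  by split=> [[ha hb]|[na nb]]; [exact: h|apply: nb; exact: h'].
split=> [[_ h] p Mp Pp G Gg Gp|h]; first by apply/E => //; exact: h.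
split=> // G Gg; have [p Gp] := filter_nonempty Gg.1.
have Pp := filter_sub Gg.1 Gp.
by apply/(E G p Gg Gp); apply: h => //; exact: (dom_M Pd).
Qed.

Lemma drel2_frc : drel2 M frc.
Proof.
have [/dfn_definable Fd _] := @FT 2 (fEq 0 1) isT.
pose F p s t := [/\ dom P p, name_seq M P 2 [:: s; t] & forces M P p (fEq 0 1) [:: s; t]].
have {}Fd : drel3 M F by [].
have : drel2 M (fun p x => F p (toname (pfst (pfst x)) p) (toname (psnd (pfst x)) p)) by dfn.
apply: dfn_iff => e eM; split=> [[Pp _ h]|]; first exact/frc_forces.
move=> [Pp h]; split=> //; last exact/frc_forces.
apply: (@name_seq_toname _ [:: _; _]) => // x.
by rewrite !inE => /orP[]/eqP ->; [apply/M_pfst/M_pfst|apply/M_psnd/M_pfst].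
Qed.

Lemma drel1_code : drel1 M code.
Proof.
have [/dfn_definable Fd _] := @FT 4 code_fml isT.
pose F e := [/\ dom P (e 0), name_seq M P 4 [:: e 1; e 2; e 3; e 4] &
  forces M P (e 0) code_fml [:: e 1; e 2; e 3; e 4]].
have {}Fd : dfn M F by [].
have Hd : dfn M (fun e => F (fun i => match i with
   | 0 => e 0
   | 1 => toname (pfst (pfst (e 1))) (e 0) | 2 => toname (psnd (pfst (e 1))) (e 0)
   | 3 => toname (pfst (psnd (e 1))) (e 0) | _ => toname (psnd (psnd (e 1))) (e 0) end)).
  have := @dfn_subst M F (fun i e => match i with
   | 0 => e 0
   | 1 => toname (pfst (pfst (e 1))) (e 0) | 2 => toname (psnd (pfst (e 1))) (e 0)
   | 3 => toname (pfst (psnd (e 1))) (e 0) | _ => toname (psnd (psnd (e 1))) (e 0) end) Fd.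
  by apply=> -[|[|[|[|i]]]]; dfn.
have : dfn M (fun e => forall p, M p -> dom P p -> F (fun i => match i with
   | 0 => p
   | 1 => toname (pfst (pfst (e 0))) p | 2 => toname (psnd (pfst (e 0))) p
   | 3 => toname (pfst (psnd (e 0))) p | _ => toname (psnd (psnd (e 0))) p end)).
  by dfn.
apply: dfn_iff => e eM; rewrite code_forces //.
split=> h p Mp Pp; first by have [] := h p Mp Pp.
split=> //=; last exact: h.
apply: (@name_seq_toname _ [:: _; _; _; _]) => // x.
have M1 := M_pfst (eM 0); have M2 := M_psnd (eM 0).
by rewrite !inE => /or4P[]/eqP ->; [exact: M_pfst|exact: M_psnd|exact: M_pfst|exact: M_psnd].
Qed.

Lemma tru_frc G x : M x -> generic M P G -> tru G x -> exists2 p, G p & frc p x.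
Proof.
move=> Mx Gg tx; have [p0 Gp0] := filter_nonempty Gg.1.
have Pp0 := filter_sub Gg.1 Gp0.
have [_ T] := @FT 2 (fEq 0 1) isT.
have [||q Gq fq] := T [:: toname (pfst (pfst x)) p0; toname (psnd (pfst x)) p0] G _ Gg.
- apply: (@name_seq_toname _ [:: _; _]) => // y.
  by rewrite !inE => /orP[]/eqP ->; [apply/M_pfst/M_pfst|apply/M_psnd/M_pfst].
- exact/(holds_eqE _ Gg.1 Gp0).
(* [q] forces an equation between names built from [p0]. A filter through [r] contains [p0] as well,
   so it evaluates the code by these names. *)
have [r [Gr rp rq]] := filter_le Gg.1 Gp0 Gq; exists r => //.
split; first exact: filter_sub Gg.1 _ Gr.
move=> H Hg Hr; apply/(holds_eqE _ Hg.1 (filter_up_le Hg.1 Hr rp)).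
exact: fq _ Hg (filter_up_le Hg.1 Hr rq).
Qed.

#[local] Hint Resolve drel2_frc drel1_code : dfn.

Definition code_eqv (x y : V) : Prop := forall p, M p -> (frc p x <-> frc p y).

Lemma drel2_code_eqv : drel2 M code_eqv.
Proof. by rewrite /code_eqv; dfn. Qed.

Lemma code_eqvP x y : M x -> M y ->
  (code_eqv x y <-> forall G, generic M P G -> (tru G x <-> tru G y)).
Proof.
move=> Mx My; split=> [h G Gg|h p Mp].
  split=> [/(tru_frc Mx Gg)|/(tru_frc My Gg)] [p Gp fp];
    have Mp := dom_M Pd (filter_sub Gg.1 Gp).
  - by have [_] := (h p Mp).1 fp; apply.
  - by have [_] := (h p Mp).2 fp; apply.
by split=> -[Pp f]; split=> // G Gg Gp; apply/h => //; exact: f.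
Qed.

(** * The Boolean algebra of classes of codes *)

Section Algebra.
Hypothesis P_sep : separative P.
Variable rep : V -> V.
Hypotheses (rep_d : dfun1 M rep)
  (repP : forall x y, M x -> M y -> (rep x = rep y <-> code_eqv x y)).
#[local] Hint Resolve rep_d : dfn.

Definition classes (b : V) : Prop := exists2 x, M x & code x /\ rep x = b.

Definition trb (G : set V) (b : V) : Prop := exists2 x, M x & rep x = b /\ tru G x.

Definition frcb (p b : V) : Prop := exists2 x, M x & rep x = b /\ frc p x.

Lemma drel1_classes : drel1 M classes.
Proof. by rewrite /classes; dfn. Qed.

Lemma drel2_frcb : drel2 M frcb.
Proof. by rewrite /frcb; dfn. Qed.
#[local] Hint Resolve drel1_classes drel2_frcb : dfn.

Lemma classes_M b : classes b -> M b.
Proof. by move=> [x Mx [_ <-]]; exact: dfun1_M rep_d Mx. Qed.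

Lemma trb_rep G x : M x -> generic M P G -> (trb G (rep x) <-> tru G x).
Proof.
move=> Mx Gg; split=> [[y My [/(repP My Mx) E ty]]|tx]; last by exists x.
exact: ((code_eqvP My Mx).1 E G Gg).1 ty.
Qed.

Lemma classes_ext b b' : classes b -> classes b' ->
  (forall G, generic M P G -> (trb G b <-> trb G b')) -> b = b'.
Proof.
move=> [x Mx [_ <-]] [y My [_ <-]] h; apply/repP => //; apply/code_eqvP => // G Gg.
by rewrite -!trb_rep //; exact: h.
Qed.

Lemma frcbP p b : classes b ->
  (frcb p b <-> dom P p /\ forall G, generic M P G -> G p -> trb G b).
Proof.
move=> [x Mx [_ <-]]; split=> [[y My [<- [Pp h]]]|[Pp h]].
  by split=> // G Gg Gp; apply/trb_rep => //; exact: h.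
by exists x => //; split=> //; split=> // G Gg Gp; apply/trb_rep => //; exact: h.
Qed.

Lemma trb_frcb G b : generic M P G -> trb G b -> exists2 p, G p & frcb p b.
Proof.
move=> Gg [x Mx [<- /(tru_frc Mx Gg)[p Gp fp]]].
by exists p => //; exists x.
Qed.

Definition expressible (S : set V -> Prop) : Prop :=
  exists2 b, classes b & forall G, generic M P G -> (trb G b <-> S G).

Definition bel (S : set V -> Prop) : V :=
  the (fun b => classes b /\ forall G, generic M P G -> (trb G b <-> S G)).

Lemma belP S : expressible S ->
  classes (bel S) /\ forall G, generic M P G -> (trb G (bel S) <-> S G).
Proof.
by move=> [b cb h]; apply: (@the_spec (fun b => classes b /\ forall G, _ -> (trb G b <-> S G)) b).
Qed.

Lemma code_expressible (S : set V -> Prop) :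
  (exists2 y, code y & forall G, generic M P G -> (tru G y <-> S G)) -> expressible S.
Proof.
move=> [y cy h]; have [My _] := cy; exists (rep y); first by exists y.
by move=> G Gg; rewrite trb_rep //; exact: h.
Qed.

Lemma expressible_compl b : classes b -> expressible (fun G => ~ trb G b).
Proof.
move=> [x Mx [cx <-]]; apply: code_expressible; have [y cy h] := code_compl cx.
by exists y => // G Gg; rewrite h // trb_rep.
Qed.

(** [A] consists of representatives, while [code_sup] needs a set of codes. Collection provides a
    set in [M] with a code for each member of [A]; keeping all its codes of classes in [A] avoids
    choosing among them. *)
Lemma expressible_sup A : M A -> elts A `<=` classes ->
  expressible (fun G => exists2 a, mem a A & trb G a).
Proof.
move=> MA AB.
have Qd : dfn M (fun e => code (e 1) /\ rep (e 1) = e 0) by dfn.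
have [| |S MS hS] := M_collection M_ZF M_tr
  (Q := fun b x _ => code x /\ rep x = b) Qd (e := fun=> A) _ MA.
- by move=> i.
- by move=> b /AB.
pose J := sep S (fun x => code x /\ mem (rep x) A).
have Jd : dfun1 M (fun S => sep S (fun x => code x /\ mem (rep x) A)) by dfn.
have [|y cy h] := code_sup (dfun1_M Jd MS); first by move=> x /mem_sep[_ []].
apply: code_expressible; exists y => // G Gg; rewrite h //; split.
  move=> [x /mem_sep[_ [[Mx _] xA]] tx]; exists (rep x) => //.
  exact/trb_rep.
move=> [a aA ta]; have [x xS [cx E]] := hS a aA; have [Mx _] := cx.
exists x; first by apply/mem_sep; rewrite E.
by apply/trb_rep => //; rewrite E.
Qed.

Lemma expressible_iff S S' : (forall G, generic M P G -> (S G <-> S' G)) ->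
  expressible S -> expressible S'.
Proof. by move=> SS' [b cb h]; exists b => // G Gg; rewrite h //; exact: SS'. Qed.

Lemma expressible_or a b : classes a -> classes b ->
  expressible (fun G => trb G a \/ trb G b).
Proof.
move=> ca cb; have MA : M (upair a b) by apply: M_upair => //; exact: classes_M.
apply: expressible_iff (expressible_sup MA _) => [G Gg|x /mem_upair[]-> //].
by split=> [[x /mem_upair[->|->] ?]|[]h]; auto; [exists a|exists b] => //;
  apply/mem_upair; auto.
Qed.

Lemma expressible_and a b : classes a -> classes b ->
  expressible (fun G => trb G a /\ trb G b).
Proof.
move=> ca cb; have [ca' ha] := belP (expressible_compl ca).
have [cb' hb] := belP (expressible_compl cb).
have [c hc] := belP (expressible_or ca' cb').
apply: expressible_iff (expressible_compl c) => G Gg.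
rewrite hc // ha // hb //.
by have [] := pselect (trb G a); have [] := pselect (trb G b); tauto.
Qed.

Lemma expressible_false : expressible (fun=> False).
Proof.
have M0 := M_emptyset M_ZF M_tr.
apply: expressible_iff (expressible_sup M0 _) => [G Gg|x /mem_emptyset//].
by split=> // -[x /mem_emptyset].
Qed.

Lemma expressible_true : expressible (fun=> True).
Proof.
have [c hc] := belP expressible_false.
by apply: expressible_iff (expressible_compl c) => G Gg; rewrite hc //; split=> // _ [].
Qed.

Lemma expressible_atom p : dom P p -> expressible (fun G => G p).
Proof. by move=> /code_atom[y cy h]; apply: code_expressible; exists y. Qed.

Definition cmeet (a b : V) : V := bel (fun G => trb G a /\ trb G b).
Definition cjoin (a b : V) : V := bel (fun G => trb G a \/ trb G b).
Definition ccompl (a : V) : V := bel (fun G => ~ trb G a).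
Definition czero : V := bel (fun=> False).
Definition cone : V := bel (fun=> True).
Definition catom (p : V) : V := bel (fun G => G p).

Lemma cmeet_dom a b : classes a -> classes b -> classes (cmeet a b).
Proof. by move=> ca cb; case: (belP (expressible_and ca cb)). Qed.
Lemma cjoin_dom a b : classes a -> classes b -> classes (cjoin a b).
Proof. by move=> ca cb; case: (belP (expressible_or ca cb)). Qed.
Lemma ccompl_dom a : classes a -> classes (ccompl a).
Proof. by move=> ca; case: (belP (expressible_compl ca)). Qed.
Lemma czero_dom : classes czero.
Proof. by case: (belP expressible_false). Qed.
Lemma cone_dom : classes cone.
Proof. by case: (belP expressible_true). Qed.
Lemma catom_dom p : dom P p -> classes (catom p).
Proof. by move=> Pp; case: (belP (expressible_atom Pp)). Qed.

Lemma trb_meet G a b : generic M P G -> classes a -> classes b ->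
  (trb G (cmeet a b) <-> trb G a /\ trb G b).
Proof. by move=> Gg ca cb; case: (belP (expressible_and ca cb)) => _; apply. Qed.
Lemma trb_join G a b : generic M P G -> classes a -> classes b ->
  (trb G (cjoin a b) <-> trb G a \/ trb G b).
Proof. by move=> Gg ca cb; case: (belP (expressible_or ca cb)) => _; apply. Qed.
Lemma trb_compl G a : generic M P G -> classes a -> (trb G (ccompl a) <-> ~ trb G a).
Proof. by move=> Gg ca; case: (belP (expressible_compl ca)) => _; apply. Qed.
Lemma trb_zero G : generic M P G -> (trb G czero <-> False).
Proof. by move=> Gg; case: (belP expressible_false) => _; apply. Qed.
Lemma trb_one G : generic M P G -> (trb G cone <-> True).
Proof. by move=> Gg; case: (belP expressible_true) => _; apply. Qed.
Lemma trb_atom G p : generic M P G -> dom P p -> (trb G (catom p) <-> G p).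
Proof. by move=> Gg Pp; case: (belP (expressible_atom Pp)) => _; apply. Qed.

#[local] Hint Resolve cmeet_dom cjoin_dom ccompl_dom czero_dom cone_dom catom_dom : core.

(** The case split supplies the excluded middle that [tauto] needs for complements. *)
Ltac bool_law := intros; apply: classes_ext; auto;
  let G := fresh "G" in let Gg := fresh "Gg" in move=> G Gg;
  rewrite ?(trb_meet Gg, trb_join Gg, trb_compl Gg, trb_zero Gg, trb_one Gg); auto;
  match goal with
  | |- context [trb G ?a] => have [] := pselect (trb G a)
  end; tauto.

Lemma cmeetC a b : classes a -> classes b -> cmeet a b = cmeet b a.
Proof. bool_law. Qed.
Lemma cjoinC a b : classes a -> classes b -> cjoin a b = cjoin b a.
Proof. bool_law. Qed.
Lemma cmeetA a b c : classes a -> classes b -> classes c ->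
  cmeet a (cmeet b c) = cmeet (cmeet a b) c.
Proof. bool_law. Qed.
Lemma cjoinA a b c : classes a -> classes b -> classes c ->
  cjoin a (cjoin b c) = cjoin (cjoin a b) c.
Proof. bool_law. Qed.
Lemma cmeetK a b : classes a -> classes b -> cmeet a (cjoin a b) = a.
Proof. bool_law. Qed.
Lemma cjoinK a b : classes a -> classes b -> cjoin a (cmeet a b) = a.
Proof. bool_law. Qed.
Lemma cmeetDr a b c : classes a -> classes b -> classes c ->
  cmeet a (cjoin b c) = cjoin (cmeet a b) (cmeet a c).
Proof. bool_law. Qed.
Lemma cmeet_compl a : classes a -> cmeet a (ccompl a) = czero.
Proof. bool_law. Qed.
Lemma cjoin_compl a : classes a -> cjoin a (ccompl a) = cone.
Proof. bool_law. Qed.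

Definition completion : boolalg := BoolAlg cmeet_dom cjoin_dom ccompl_dom
  czero_dom cone_dom cmeetC cjoinC cmeetA cjoinA cmeetK cjoinK cmeetDr
  cmeet_compl cjoin_compl.

Lemma completion_le a b : classes a -> classes b ->
  (ble completion a b <-> forall G, generic M P G -> trb G a -> trb G b).
Proof.
move=> ca cb; rewrite /ble /=; split=> [E G Gg|h].
  by rewrite -E => /(trb_meet Gg ca cb)[].
by apply: classes_ext => [||G Gg]; auto; rewrite trb_meet //; split=> [[]|]; auto.
Qed.

Lemma completion_complete : complete_in M completion.
Proof.
move=> A MA AB; have [s cs h] := expressible_sup MA AB; exists s; split=> //.
  move=> a aA; apply/completion_le => //; first exact: AB.
  by move=> G Gg ta; apply/h => //; exists a.
move=> u cu hu; apply/completion_le => // G Gg /h[]// a aA ta.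
by move: (hu a aA) => /(completion_le (AB a aA) cu); apply.
Qed.

(** If [p] is not below [q], separativity yields [r] below [p] incompatible with [q], and a generic
    filter through [r] contains [p] but not [q]. *)
Lemma atom_le p q : dom P p -> dom P q ->
  (ple P p q <-> forall G, generic M P G -> G p -> G q).
Proof.
move=> Pp Pq; split=> [pq G Gg Gp|h]; first exact: filter_up Gg.1 _ _ Gp Pq pq.
apply: contrapT => /(P_sep Pp Pq)[r [Pr rp rq]].
have [G Gg Gr] := generic_ex M_countable Pr.
have Gq := h G Gg (filter_up Gg.1 Gr Pp rp).
have [s [Gs sr sq]] := filter_directed Gg.1 Gr Gq.
by apply: rq; exists s; split=> //; exact: filter_sub Gg.1 _ Gs.
Qed.

Lemma completion_embedding : dense_embedding P completion catom.
Proof.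
split=> [p Pp|p q Pp Pq E|p q Pp Pq|b cb nz].
- split; first exact: catom_dom.
  move=> E; have [G Gg Gp] := generic_ex M_countable Pp.
  by apply/(trb_zero Gg); rewrite -[czero]E; apply/trb_atom.
- by apply: (@ple_antisym P) => //; apply/atom_le => // G Gg;
    rewrite -(trb_atom Gg Pp) -(trb_atom Gg Pq) E.
- rewrite atom_le // completion_le; auto.
  by split=> h G Gg; move: (h G Gg); rewrite !trb_atom.
(* A nonzero class holds in some generic filter, so by the truth lemma some condition forces it, and
   the atom of that condition lies below it. *)
- apply: contrapT => n; apply: nz; apply: classes_ext => // G Gg.
  rewrite trb_zero //; split=> // /(trb_frcb Gg)[p Gp /(frcbP _ cb)[Pp h]].
  apply: n; exists p => //; apply/completion_le; auto => H Hg /(trb_atom Hg Pp).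
  exact: h.
Qed.

(** * Definability of the completion over the model *)

(** [bel] refers to generic filters, so it gives no definition over [M]. The operations are
    recovered from the conditions forcing a class, which determine it. *)
Lemma frcb_ext b b' : classes b -> classes b' ->
  (forall p, M p -> (frcb p b <-> frcb p b')) -> b = b'.
Proof.
move=> cb cb' h; apply: classes_ext => // G Gg.
split=> /(trb_frcb Gg)[p Gp fp]; have Mp := dom_M Pd (filter_sub Gg.1 Gp).
  by have [_] := (frcbP p cb').1 ((h p Mp).1 fp); apply.
by have [_] := (frcbP p cb).1 ((h p Mp).2 fp); apply.
Qed.

Lemma frcb_meet p a b : classes a -> classes b ->
  (frcb p (cmeet a b) <-> frcb p a /\ frcb p b).
Proof.
move=> ca cb; rewrite !frcbP; auto; split=> [[Pp h]|[[Pp h] [_ h']]].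
  by split; split=> // G Gg Gp; have /(trb_meet Gg ca cb)[] := h G Gg Gp.
by split=> // G Gg Gp; apply/trb_meet; auto.
Qed.

Lemma frcb_compl p a : classes a ->
  (frcb p (ccompl a) <-> dom P p /\ forall q, M q -> le P q p -> ~ frcb q a).
Proof.
move=> ca; rewrite frcbP; auto; split=> -[Pp h]; split=> //.
  move=> q Mq qp /(frcbP _ ca)[Pq h'].
  have [G Gg Gq] := generic_ex M_countable Pq.
  by have /(trb_compl Gg ca) := h G Gg (filter_up_le Gg.1 Gq qp); apply; exact: h'.
move=> G Gg Gp; apply/trb_compl => // /(trb_frcb Gg)[q Gq fq].
have [r [Gr rp rq]] := filter_le Gg.1 Gp Gq; have [Pr _ _] := rp.
apply: (h r) => //; first exact: dom_M Pd _ Pr.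
have [_ hq] := (frcbP _ ca).1 fq; apply/frcbP => //; split=> // H Hg Hr.
exact: hq (filter_up_le Hg.1 Hr rq).
Qed.

(** A condition may force a join without forcing either side, so the join is defined through
    complements and meets, whose forcing reduces to that of their arguments. *)
Lemma cjoinE a b : classes a -> classes b ->
  cjoin a b = ccompl (cmeet (ccompl a) (ccompl b)).
Proof.
move=> ca cb; apply: classes_ext => [||G Gg]; auto.
rewrite (trb_join Gg ca cb) trb_compl ?(trb_meet Gg) ?(trb_compl Gg); auto.
by have [] := pselect (trb G a); have [] := pselect (trb G b); tauto.
Qed.

Lemma definable_classes : definable_set M classes.
Proof.
exact: (definable_setI (M_emptyset M_ZF M_tr) (fun b => @classes_M b) drel1_classes).
Qed.

Lemma definable_fun1I (A : set V) (f : V -> V) (R : V -> V -> Prop) : A `<=` M ->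
  (forall a, A a -> M (f a)) -> drel2 M R -> (forall a z, M a -> M z -> (R a z <-> A a /\ z = f a)) ->
  definable_fun1 M A f.
Proof.
move=> AM fM Rd RP; apply: (definable_dfn (e0 := fun=> emptyset) _ Rd).
  by move=> i; exact: M_emptyset.
case=> [|a [|z [|? ?]]] /=; try by split=> // -[].
split=> [[Aa ->]|[_ sM /RP[]//]].
  split=> //; last by apply/RP; auto.
  by move=> x; rewrite !inE => /orP[]/eqP ->; auto.
all: by apply: sM; rewrite !inE eqxx ?orbT.
Qed.

Lemma definable_fun2I (A : set V) (f : V -> V -> V) (R : V -> V -> V -> Prop) : A `<=` M ->
  (forall a b, A a -> A b -> M (f a b)) -> drel3 M R ->
  (forall a b z, M a -> M b -> M z -> (R a b z <-> [/\ A a, A b & z = f a b])) ->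
  definable_fun2 M A f.
Proof.
move=> AM fM Rd RP; apply: (definable_dfn (e0 := fun=> emptyset) _ Rd).
  by move=> i; exact: M_emptyset.
case=> [|a [|b [|z [|? ?]]]] /=; try by split=> // -[].
split=> [[Aa Ab ->]|[_ sM /RP[]//]].
  split=> //; last by apply/RP; auto.
  by move=> x; rewrite !inE => /or3P[]/eqP ->; auto.
all: by apply: sM; rewrite !inE eqxx ?orbT.
Qed.

Lemma completion_definable : boolalg_definable M completion.
Proof.
have cM : classes `<=` M by exact: classes_M.
pose Rc a z := [/\ classes a, classes z & forall p, M p ->
  (frcb p z <-> dom P p /\ forall q, M q -> le P q p -> ~ frcb q a)].
have Rc_d : drel2 M Rc by rewrite /Rc; dfn.
have RcP a z : M a -> M z -> (Rc a z <-> classes a /\ z = ccompl a).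
  move=> Ma Mz; split=> [[ca cz h]|[ca ->]]; split; auto.
    by apply: frcb_ext; auto => p Mp; rewrite frcb_compl //; exact: h.
  by move=> p Mp; exact: frcb_compl.
pose Rm a b z := (classes a /\ classes b) /\ (classes z /\ forall p, M p ->
  (frcb p z <-> frcb p a /\ frcb p b)).
have Rm_d : drel3 M Rm by rewrite /Rm; dfn.
have RmP a b z : M a -> M b -> M z ->
    (Rm a b z <-> [/\ classes a, classes b & z = cmeet a b]).
  move=> Ma Mb Mz; split=> [[[ca cb] [cz h]]|[ca cb ->]].
    by split=> //; apply: frcb_ext; auto => p Mp; rewrite frcb_meet //; exact: h.
  by split=> //; split=> [|p Mp]; [auto|exact: frcb_meet].
pose Rj a b z := exists2 a', M a' & exists2 b', M b' & exists2 c, M c &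
  [/\ Rc a a', Rc b b' & Rm a' b' c /\ Rc c z].
have Rj_d : drel3 M Rj by rewrite /Rj; dfn.
split=> /=.
- exact: definable_classes.
- by apply: definable_fun2I RmP => // a b ca cb; apply: cM; auto.
- apply: definable_fun2I Rj_d _ => // [a b ca cb|a b z Ma Mb Mz]; first by apply: cM; auto.
  split=> [[a' Ma' [b' Mb' [c Mc [ha hb [hm hc]]]]]|[ca cb ->]].
    have [ca ea] := (RcP a a' Ma Ma').1 ha; have [cb eb] := (RcP b b' Mb Mb').1 hb.
    have [_ _ ec] := (RmP a' b' c Ma' Mb' Mc).1 hm.
    have [_ ez] := (RcP c z Mc Mz).1 hc.
    by split=> //; rewrite ez ec ea eb cjoinE.
  have ca' : classes (ccompl a) by auto.
  have cb' : classes (ccompl b) by auto.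
  have cc : classes (cmeet (ccompl a) (ccompl b)) by auto.
  exists (ccompl a); first exact: cM.
  exists (ccompl b); first exact: cM.
  exists (cmeet (ccompl a) (ccompl b)); first exact: cM.
  rewrite cjoinE //; split; [| |split]; [apply/RcP|apply/RcP|apply/RmP|apply/RcP];
    try exact: cM; by [|auto].
- by apply: definable_fun1I Rc_d RcP => // a ca; apply: cM; auto.
- split; apply: (definable_setI (M_emptyset M_ZF M_tr)).
  + by move=> _ ->; apply: cM.
  + have Mz : M czero by apply: cM.
    by apply: (dfn_eq (dfnf_var M 0) (dfnf_const Mz)).
  + by move=> _ ->; apply: cM.
  + have Mo : M cone by apply: cM.
    by apply: (dfn_eq (dfnf_var M 0) (dfnf_const Mo)).
Qed.

Lemma atom_definable : definable_fun1 M (dom P) catom.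
Proof.
pose R p z := [/\ dom P p, classes z & forall q, M q -> (frcb q z <-> le P q p)].
have Rd : drel2 M R by rewrite /R; dfn.
(* By separativity the conditions forcing [catom p] are exactly those below [p], which characterizes
   this class over [M]. *)
have f q p : dom P p -> (frcb q (catom p) <-> le P q p).
  move=> Pp; rewrite frcbP; auto; split=> [[Pq h]|[Pq _ qp]]; split=> //.
    by apply/atom_le => // G Gg Gq; apply/(trb_atom Gg Pp); exact: h.
  move=> G Gg Gq; apply/trb_atom => //; exact: filter_up Gg.1 _ _ Gq Pp qp.
apply: definable_fun1I Rd _ => [p|p Pp|p z Mp Mz]; first exact: dom_M.
  by apply: classes_M; auto.
split=> [[Pp cz h]|[Pp ->]]; split; auto.
by apply: frcb_ext; auto => q Mq; rewrite f //; exact: h.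
Qed.

Lemma forcing_theorem_completion : has_boolean_completion M P.
Proof.
exists completion, catom; split.
- exact: completion_definable.
- exact: completion_complete.
- exact: completion_embedding.
- exact: atom_definable.
Qed.

End Algebra.

End Codes.

Theorem theorem1p2 (M : V) (P : porder)
  (M_countable : countable (elts M))
  (M_transitive : is_transitive (elts M))
  (M_ZFminus : ZFminus (elts M))
  (P_separative : separative P)
  (P_definable : porder_definable (elts M) P)
  (M_powerset_or_wo : powerset_axiom (elts M) \/
     exists R : V -> V -> Prop,
       is_well_order (elts M) R /\ definable_rel (elts M) (elts M) R) :
  (forall (n : nat) (phi : formula), fv_below n phi ->
     forcing_theorem (elts M) P n phi)
  <-> has_boolean_completion (elts M) P.
Proof.
split=> [FT|[B [pi [Bd Bc pi_emb pid]]] n phi _]; last first.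
  exact: (completion_forcing_theorem M_ZFminus M_transitive M_countable P_definable
            Bd Bc pi_emb pid).
have Ed := drel2_code_eqv M_ZFminus M_transitive P_definable FT.
have Er x : elts M x -> code_eqv (elts M) P x x by move=> _ p _.
have Es x y : elts M x -> elts M y -> code_eqv (elts M) P x y -> code_eqv (elts M) P y x.
  by move=> _ _ h p Mp; have [h1 h2] := h p Mp; split.
have Et x y z : elts M x -> elts M y -> elts M z ->
    code_eqv (elts M) P x y -> code_eqv (elts M) P y z -> code_eqv (elts M) P x z.
  by move=> _ _ _ h h' p Mp; rewrite (h p Mp); exact: h'.
(* The power set axiom or the definable well-order enters here, to pick representatives of the
   classes of codes definably. *)
have [rep [rep_d repP]] : exists rep, dfun1 (elts M) rep /\ forall x y,
    elts M x -> elts M y -> (rep x = rep y <-> code_eqv (elts M) P x y).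
  case: M_powerset_or_wo => [pw|[R [Rwo Rd]]].
    exact: (scott_quotient M_ZFminus M_transitive pw Ed Er Es Et).
  exact: (wo_quotient M_ZFminus M_transitive Rwo Rd Ed Er Es Et).
exact: (forcing_theorem_completion M_ZFminus M_transitive M_countable P_definable
          FT P_separative rep_d repP).
Qed.
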